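(* Let $M\in\mathcal A$ be an indecomposable rigid module and let $P$ be an indecomposable projective module in $\mathcal A$. Then $$g(X_M)=-\operatorname{ind}^\circ(C_M)\quad\text{and}\quad g(X_{P[1]})=-\operatorname{ind}^\circ(Z_P).$$
   Context: Let $k=\mathbb{F}_q$, $v=\sqrt q$. Let $Q$ be a finite acyclic valued quiver with vertices $1,\dots,n$ and valuations $d_1,\dots,d_n$. Let $\widetilde Q$ be the valued quiver with vertices $1,\dots,2n$ obtained from $Q$ by adding, for each $1\le i\le n$, a vertex $n+i$ and an arrow $n+i\to i$ (with $d_{n+i}=d_i$). Let $\mathfrak S,\widetilde{\mathfrak S}$ be the associated $k$-species, identified with their tensor algebras, with the convention that an arrow $i\to j$ gives $\operatorname{Ext}^1(S_i,S_j)\ne0$, where $S_i$ is the $i$-th simple $\widetilde{\mathfrak S}$-module; $\mathcal D_i=\operatorname{End}_{\widetilde{\mathfrak S}}(S_i)$ has $k$-dimension $d_i$. Let $m=2n$ and let $\widetilde R,\widetilde R'$ be the $m\times n$ matrices with entries $r_{ij}=\dim_{\mathcal D_i}\operatorname{Ext}^1_{\widetilde{\mathfrak S}}(S_j,S_i)$, $r'_{ij}=\dim_{\mathcal D_i^{op}}\operatorname{Ext}^1_{\widetilde{\mathfrak S}}(S_i,S_j)$; $\widetilde I$ the left $m\times n$ submatrix of $I_m$; $\widetilde B=\widetilde R'-\widetilde R$, with upper $n\times n$ block $B$ and lower block $I_n$; $\widetilde E=\widetilde I-\widetilde R'$. Let $\Lambda$ be a skew-symmetric integral $m\times m$ matrix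 with $\Lambda(-\widetilde B)=\binom{D_n}{0}$, $D_n=\mathrm{diag}(d_1,\dots,d_n)$. $\mathcal T_\Lambda$ is the $\mathbb{Z}[v,v^{-1}]$-algebra with basis $\{X^\alpha:\alpha\in\mathbb{Z}^{2n}\}$ and product $X^\alpha\star X^\beta=v^{\Lambda(\alpha,\beta)}X^{\alpha+\beta}$. $\mathcal A$ is the category of finite dimensional left $\mathfrak S$-modules, $\mathscr P$ its projectives, $\langle\cdot,\cdot\rangle$ its Euler form on $K(\mathcal A)=\mathbb{Z}^n$ (via dimension vectors). $M$ is rigid if $\operatorname{Ext}^1_{\mathcal A}(M,M)=0$. For $M\in\mathcal A$, $P\in\mathscr P$ with dimension vectors $\mathbf m,\mathbf p$, $$X_{M\oplus P[1]}=\sum_{\mathbf e}v^{\langle\mathbf p-\mathbf e,\mathbf m-\mathbf e\rangle}|\mathrm{Gr}_{\mathbf e}M|\,X^{-\widetilde B\mathbf e-\widetilde E\mathbf m+\mathbf t_P}\in\mathcal T_\Lambda,$$ where $\mathrm{Gr}_{\mathbf e}M$ is the set of submodules of dimension vector $\mathbf e$ and $\mathbf t_P=\mathbf{dim}(P/\operatorname{rad}P)$ viewed in $\mathbb{Z}^{2n}$ by adding zeros; $X_M$ and $X_{P[1]}$ are the cases $P=0$ and $M=0$. The elements $X_M$ ($M$ indecomposable rigid) and $X_{P[1]}$ ($P$ indecomposable projective) are precisely the non-frozen quantum cluster variables of the quantum cluster algebra of $(\Lambda,\widetilde B)$. Grading and $g$-vectors: $\mathcal T_\Lambda$ is $\mathbb{Z}^n$-graded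 by $\deg X^\alpha=\sum_{i=1}^na_ie_i-\sum_{j=1}^na_{n+j}\beta_j$ for $\alpha=(a_1,\dots,a_{2n})^{\rm tr}$, where $e_i$ are the standard basis vectors of $\mathbb{Z}^n$ and $\beta_j$ is the $j$-th column of $B$. Every quantum cluster variable $z$ is homogeneous and its $g$-vector $g(z)$ is its degree. Index: let $P_1,\dots,P_n$ be the indecomposable projectives of $\mathcal A$ ($P_i$ with top $S_i$). $C_2(\mathscr P)$ is the exact category of morphisms $M_{-1}\to M_0$ in $\mathscr P$ (morphisms: commutative squares). For $P\in\mathscr P$, $K_P=(P\xrightarrow{1}P)$, $Z_P=(P\to0)$; for $M\in\mathcal A$ with minimal projective resolution $0\to\Omega_M\xrightarrow{\delta_M}P_M\to M\to0$, $C_M=(\Omega_M\xrightarrow{\delta_M}P_M)$ (so $C_P=(0\to P)$ for $P\in\mathscr P$). The classes $\hat C_{P_1},\dots,\hat C_{P_n},\hat K_{P_1},\dots,\hat K_{P_n}$ form a $\mathbb{Z}$-basis of the Grothendieck group $K(C_2(\mathscr P))$; for $M_\bullet\in C_2(\mathscr P)$ let $(h_1,\dots,h_{2n})^{\rm tr}$ be the coordinate vector of $\hat M_\bullet$ in this basis and $\operatorname{ind}^\circ(M_\bullet)=(h_1,\dots,h_n)^{\rm tr}$. *)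

(* Defs.v *)
From HB Require Import structures.
From mathcomp Require Import all_boot all_order all_algebra all_field.
From mathcomp Require Import finmap.
From mathcomp Require Import boolp classical_sets functions cardinality.
From mathcomp Require Import monalg ring.

Set Implicit Arguments.
Unset Strict Implicit.
Unset Printing Implicit Defensive.

Import Order.TTheory GRing.Theory Num.Theory.
Local Open Scope ring_scope.

(* v = sqrt q, and Z[v, v^-1] as a subring of the algebraic numbers. *)
Definition vroot (k : finFieldType) : algC := sqrtC (#|k|%:R).

Definition is_Zv (k : finFieldType) (x : algC) : Prop :=
  exists (N : nat) (p : {poly int}),
    x * vroot k ^+ N = (map_poly intr p).[vroot k].

Definition Zv_pred (k : finFieldType) : {pred algC} := fun x => `[< is_Zv k x >].

Lemma vroot_neq0 k : vroot k != 0.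
Proof. by rewrite sqrtC_eq0 pnatr_eq0 -lt0n; apply/card_gt0P; exists 0. Qed.

Fact Zv_subring k : subring_closed (Zv_pred k).
Proof.
split=> [|x y|x y].
- apply/asboolP; exists 0, 1.
  by rewrite rmorph1 hornerC expr0 mulr1.
- move=> /asboolP[N [p hp]] /asboolP[L [r hr]]; apply/asboolP.
  exists (N + L)%N, ('X^L * p - 'X^N * r).
  rewrite rmorphB !rmorphM /= !map_polyXn hornerD hornerN !hornerM !hornerXn.
  by rewrite -hp -hr mulrBl exprD mulrA [x * _ * _]mulrC [y * _]mulrCA.
- move=> /asboolP[N [p hp]] /asboolP[L [r hr]]; apply/asboolP.
  exists (N + L)%N, (p * r).
  by rewrite rmorphM /= hornerM -hp -hr exprD mulrACA.
Qed.

HB.instance Definition _ k :=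
  GRing.isSubringClosed.Build algC (Zv_pred k) (Zv_subring k).

Definition Zv (k : finFieldType) := {x : algC | Zv_pred k x}.
HB.instance Definition _ k := [isSub of Zv k for @sval _ _].
HB.instance Definition _ k := [Choice of Zv k by <:].
HB.instance Definition _ k := [SubChoice_isSubComNzRing of Zv k by <:].

Fact vpow_subproof k (z : int) : Zv_pred k (vroot k ^ z).
Proof.
apply/asboolP; case: z => m.
- by exists 0, ('X^m); rewrite map_polyXn hornerXn expr0 mulr1.
- exists m.+1, 1; rewrite rmorph1 hornerC NegzE -exprnN mulVf //.
  by rewrite expf_neq0 ?vroot_neq0.
Qed.

Definition vpow k (z : int) : Zv k := Sub (vroot k ^ z) (vpow_subproof k z).

Lemma vpow0 k : vpow k 0 = 1.
Proof. exact/val_inj. Qed.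

Lemma vpowD k a b : vpow k (a + b) = vpow k a * vpow k b.
Proof. by apply/val_inj => /=; rewrite expfzDr ?vroot_neq0. Qed.

Definition lform m (L : 'M[int]_m) (a b : 'cV[int]_m) : int :=
  (a^T *m L *m b) 0 0.

Section TwistedProduct.
Variables (R : comNzRingType) (w : int -> R).
Hypotheses (w0 : w 0 = 1) (wD : forall a b, w (a + b) = w a * w b).
Variables (m : nat) (L : 'M[int]_m).

Local Notation lform := (lform L).
Local Notation T := {malg R['cV[int]_m]}.
Implicit Types (f g h : T).

Definition qtmul f g : T :=
  \sum_(a <- msupp f) \sum_(b <- msupp g)
     << f@_a * g@_b * w (lform a b) *g a + b >>.

Local Notation T2 a b c d := (<< c * d * w (lform a b) *g a + b >> : T).

Lemma qtmulw (A B : {fset 'cV[int]_m}) f g :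
  (msupp f `<=` A)%fset -> (msupp g `<=` B)%fset ->
  qtmul f g = \sum_(a <- A) \sum_(b <- B) T2 a b f@_a g@_b.
Proof.
move=> hA hB; rewrite /qtmul (big_fset_incl _ hA) /=; last first.
  move=> a _ /mcoeff_outdom ->; rewrite big1 // => b _.
  by rewrite !mul0r monalgU0.
apply: eq_bigr => a _; rewrite (big_fset_incl _ hB) //= => b _ /mcoeff_outdom ->.
by rewrite mulr0 mul0r monalgU0.
Qed.

Lemma qtmulDl : left_distributive qtmul +%R.
Proof.
move=> f g h; pose A := (msupp f `|` msupp g `|` msupp (f + g))%fset.
have s1 : (msupp f `<=` A)%fset by rewrite /A -fsetUA fsubsetUl.
have s2 : (msupp g `<=` A)%fset by rewrite /A fsetUAC fsubsetUr.
have s3 : (msupp (f + g) `<=` A)%fset by rewrite /A fsubsetUr.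
rewrite (qtmulw s3 (fsubset_refl _)) (qtmulw s1 (fsubset_refl _)).
rewrite (qtmulw s2 (fsubset_refl _)) -big_split /=; apply: eq_bigr => a _.
rewrite -big_split /=; apply: eq_bigr => b _.
by rewrite -monalgUD mcoeffD !mulrDl.
Qed.

Lemma qtmulDr : right_distributive qtmul +%R.
Proof.
move=> h f g; pose A := (msupp f `|` msupp g `|` msupp (f + g))%fset.
have s1 : (msupp f `<=` A)%fset by rewrite /A -fsetUA fsubsetUl.
have s2 : (msupp g `<=` A)%fset by rewrite /A fsetUAC fsubsetUr.
have s3 : (msupp (f + g) `<=` A)%fset by rewrite /A fsubsetUr.
rewrite (qtmulw (fsubset_refl _) s3) (qtmulw (fsubset_refl _) s1).
rewrite (qtmulw (fsubset_refl _) s2) -big_split /=; apply: eq_bigr => a _.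
rewrite -big_split /=; apply: eq_bigr => b _.
by rewrite -monalgUD mcoeffD mulrDr mulrDl.
Qed.

Lemma qtmul0l f : qtmul 0 f = 0.
Proof. by rewrite /qtmul msupp0 big_seq_fset0. Qed.

Lemma qtmul0r f : qtmul f 0 = 0.
Proof.
by rewrite /qtmul big1 // => a _; rewrite msupp0 big_seq_fset0.
Qed.

Lemma qtmul_suml (I : Type) (r : seq I) (F : I -> T) g :
  qtmul (\sum_(i <- r) F i) g = \sum_(i <- r) qtmul (F i) g.
Proof.
by apply: (big_morph (fun f => qtmul f g)); [move=> x y; rewrite qtmulDl | rewrite qtmul0l].
Qed.

Lemma qtmul_sumr (I : Type) (r : seq I) (F : I -> T) g :
  qtmul g (\sum_(i <- r) F i) = \sum_(i <- r) qtmul g (F i).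
Proof.
by apply: (big_morph (fun f => qtmul g f)); [move=> x y; rewrite qtmulDr | rewrite qtmul0r].
Qed.

Lemma qtmulUU a b c d : qtmul << c *g a >> << d *g b >> = T2 a b c d.
Proof.
rewrite (qtmulw (msuppU_le (x := c)) (msuppU_le (x := d))).
by rewrite !big_seq_fset1 !mcoeffUU.
Qed.

Lemma lformDl a b c : lform (a + b) c = lform a c + lform b c.
Proof. by rewrite /lform linearD !mulmxDl mxE. Qed.

Lemma lformDr a b c : lform c (a + b) = lform c a + lform c b.
Proof. by rewrite /lform mulmxDr mxE. Qed.

Lemma qtmulA : associative qtmul.
Proof.
move=> f g h; pose U (f : T) a : T := << f@_a *g a >>.
have E (f' : T) : f' = \sum_(a <- msupp f') U f' a by exact: monalgE.
have Sl x y : qtmul x y = \sum_(a <- msupp x) qtmul (U x a) y.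
  by rewrite -qtmul_suml -E.
have Sr x y : qtmul x y = \sum_(a <- msupp y) qtmul x (U y a).
  by rewrite -qtmul_sumr -E.
rewrite (Sl f (qtmul g h)) (Sl f g) qtmul_suml; apply: eq_bigr => a _.
rewrite (Sl g h) (Sr (U f a) g) qtmul_sumr qtmul_suml; apply: eq_bigr => b _.
rewrite (Sr (U g b) h) (Sr (qtmul (U f a) (U g b)) h) qtmul_sumr; apply: eq_bigr => c _.
rewrite [in LHS](qtmulUU b c g@_b h@_c) [in LHS]qtmulUU.
rewrite [in RHS](qtmulUU a b f@_a g@_b) [in RHS]qtmulUU addrA.
have -> // : f@_a * (g@_b * h@_c * w (lform b c)) * w (lform a (b + c))
  = f@_a * g@_b * w (lform a b) * h@_c * w (lform (a + b) c).
by rewrite lformDl lformDr !wD; ring.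
Qed.
Definition qtone : T := << 1 *g 0 >>.

Lemma lform0l a : lform 0 a = 0.
Proof. by rewrite /lform trmx0 !mul0mx mxE. Qed.

Lemma lform0r a : lform a 0 = 0.
Proof. by rewrite /lform mulmx0 mxE. Qed.

Lemma qtmul1l : left_id qtone qtmul.
Proof.
move=> f; rewrite (qtmulw (msuppU_le (x := 1)) (fsubset_refl _)) big_seq_fset1.
rewrite [RHS]monalgE; apply: eq_bigr => a _.
by rewrite mcoeffUU lform0l w0 mul1r mulr1 add0r.
Qed.

Lemma qtmul1r : right_id qtone qtmul.
Proof.
move=> f; rewrite (qtmulw (fsubset_refl _) (msuppU_le (x := 1))).
rewrite [RHS]monalgE; apply: eq_bigr => a _.
by rewrite big_seq_fset1 mcoeffUU lform0r w0 !mulr1 addr0.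
Qed.

Lemma qtone_neq0 : qtone != 0.
Proof. by rewrite monalgU_eq0 oner_eq0. Qed.

Lemma monalgZU (c x : R) a : c *: (<< x *g a >> : T) = << c * x *g a >>.
Proof.
apply/malgP => b; rewrite mcoeffZ [in LHS]mcoeffU [in RHS]mcoeffU.
exact: mulrnAr.
Qed.

Lemma qtmulAl c f g : c *: qtmul f g = qtmul (c *: f) g.
Proof.
rewrite (qtmulw (msuppZ_le c f) (fsubset_refl _)) /qtmul scaler_sumr.
apply: eq_bigr => a _; rewrite scaler_sumr; apply: eq_bigr => b _.
by rewrite monalgZU mcoeffZ !mulrA.
Qed.

Lemma qtmulAr c f g : c *: qtmul f g = qtmul f (c *: g).
Proof.
rewrite (qtmulw (fsubset_refl _) (msuppZ_le c g)) /qtmul scaler_sumr.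
apply: eq_bigr => a _; rewrite scaler_sumr; apply: eq_bigr => b _.
by rewrite monalgZU mcoeffZ !mulrA [c * _]mulrC.
Qed.

End TwistedProduct.

Definition qtorus (k : finFieldType) m (L : 'M[int]_m) :=
  {malg (Zv k)['cV[int]_m]}.

Section QuantumTorus.
Variables (k : finFieldType) (m : nat) (L : 'M[int]_m).

HB.instance Definition _ := GRing.Lmodule.on (qtorus k L).
HB.instance Definition _ := GRing.Zmodule_isNzRing.Build (qtorus k L)
  (qtmulA (@vpowD k) L) (qtmul1l (vpow0 k) L) (qtmul1r (vpow0 k) L)
  (qtmulDl (@vpow k) L) (qtmulDr (@vpow k) L) (qtone_neq0 (Zv k) m).
HB.instance Definition _ :=
  GRing.Lmodule_isLalgebra.Build (Zv k) (qtorus k L) (qtmulAl (@vpow k) L).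
HB.instance Definition _ :=
  GRing.Lalgebra_isAlgebra.Build (Zv k) (qtorus k L) (qtmulAr (@vpow k) L).

Definition Xmon (a : 'cV[int]_m) : qtorus k L := << 1 *g a >>.

Lemma XmonM a b : Xmon a * Xmon b = vpow k (lform L a b) *: Xmon (a + b).
Proof.
by rewrite [LHS](qtmulUU (@vpow k)) !mul1r /Xmon monalgZU mulr1.
Qed.

End QuantumTorus.

(* [vq_arr i j] is the number of arrows i -> j. *)
Record vquiver (I : finType) := VQuiver {
  vq_val : I -> nat;
  vq_val_gt0 : forall i, (0 < vq_val i)%N;
  vq_arr : I -> I -> nat
}.

Definition acyclic (I : finType) (Q : vquiver I) : Prop :=
  forall (i : I) (p : seq I),
    path (fun x y => 0 < vq_arr Q x y)%N i p -> last i p = i -> p = [::].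

(* The quiver with an extra vertex inr i and an arrow inr i -> inl i for each
   vertex i. *)
Definition framed_quiver (I : finType) (Q : vquiver I) : vquiver (I + I)%type :=
  @VQuiver (I + I)%type
    (fun x => match x with inl i | inr i => vq_val Q i end)
    (fun x => match x with inl i | inr i => vq_val_gt0 Q i end)
    (fun x y => match x, y with
                | inl i, inl j => vq_arr Q i j
                | inr i, inl j => (i == j)%N
                | _, inr _ => 0%N
                end).

(* E-F-bimodules on which k acts centrally. *)
Record bimodule (k : finFieldType) (E F : fieldExtType k) := Bimodule {
  bim_sort :> vectType k;
  bim_l : 'Hom(E, 'End(bim_sort));
  bim_r : 'Hom(F, 'End(bim_sort));
  bim_l1 : forall m, bim_l 1 m = m;
  bim_r1 : forall m, bim_r 1 m = m;
  bim_lM : forall a b m, bim_l (a * b) m = bim_l a (bim_l b m);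
  bim_rM : forall a b m, bim_r (a * b) m = bim_r b (bim_r a m);
  bim_lr : forall a b m, bim_l a (bim_r b m) = bim_r b (bim_l a m)
}.

(* Over a finite field, the valued quiver determines the dimensions of the
   division algebras (which are fields) and of the bimodules, a bimodule over
   F_{q^a} and F_{q^b} having k-dimension a multiple of lcm(a, b): one copy of
   F_{q^lcm(a, b)} for each arrow. *)
Record species (k : finFieldType) (I : finType) (Q : vquiver I) := Species {
  sp_D : I -> fieldExtType k;
  sp_B : forall i j, bimodule (sp_D j) (sp_D i);
  sp_dimD : forall i, \dim {:sp_D i} = vq_val Q i;
  sp_dimB : forall i j, \dim {:sp_B i j} =
    (vq_arr Q i j * lcmn (vq_val Q i) (vq_val Q j))%N
}.

Section FramedSpecies.
Variable k : finFieldType.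

Definition lmulD (E : fieldExtType k) : 'Hom(E, 'End(E)) := linfun (@amulr k E).

Lemma lmulDE (E : fieldExtType k) (a x : E) : lmulD E a x = a * x.
Proof. by rewrite /lmulD lfunE /= /amulr lfunE /= mulrC. Qed.

Program Definition regular_bimodule (E : fieldExtType k) : bimodule E E :=
  @Bimodule k E E E (lmulD E) (lmulD E) _ _ _ _ _.
Next Obligation. by rewrite lmulDE mul1r. Qed.
Next Obligation. by rewrite lmulDE mul1r. Qed.
Next Obligation. by rewrite !lmulDE mulrA. Qed.
Next Obligation. by rewrite !lmulDE mulrCA mulrA. Qed.
Next Obligation. by rewrite !lmulDE mulrCA. Qed.

Lemma rV0_eq (x y : 'rV[k]_0) : x = y.
Proof. by rewrite (thinmx0 x) (thinmx0 y). Qed.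

Definition zero_bimodule (E F : fieldExtType k) : bimodule E F :=
  @Bimodule k E F 'rV[k]_0 0 0 (fun _ => rV0_eq _ _) (fun _ => rV0_eq _ _)
    (fun _ _ _ => rV0_eq _ _) (fun _ _ _ => rV0_eq _ _) (fun _ _ _ => rV0_eq _ _).

Variables (I : finType) (Q : vquiver I) (S : species k Q).

Definition framed_D (x : I + I) : fieldExtType k :=
  match x with inl i | inr i => sp_D S i end.

Definition framing_bimodule (i j : I) : bimodule (sp_D S j) (sp_D S i) :=
  match i =P j with
  | ReflectT e => ecast z (bimodule (sp_D S z) (sp_D S i)) e
                    (regular_bimodule (sp_D S i))
  | ReflectF _ => zero_bimodule _ _
  end.

Definition framed_B (x y : I + I) : bimodule (framed_D y) (framed_D x) :=
  match x, y with
  | inl i, inl j => sp_B S i j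
  | inr i, inl j => framing_bimodule i j
  | inl i, inr j => zero_bimodule _ _
  | inr i, inr j => zero_bimodule _ _
  end.

Fact framed_dimD x : \dim {:framed_D x} = vq_val (framed_quiver Q) x.
Proof. by case: x => i; apply: sp_dimD. Qed.

Lemma dim_rV0 : \dim {:'rV[k]_0} = 0%N.
Proof. by rewrite dimvf /dim /= muln0. Qed.

Fact framed_dimB x y : \dim {:framed_B x y} =
  (vq_arr (framed_quiver Q) x y *
     lcmn (vq_val (framed_quiver Q) x) (vq_val (framed_quiver Q) y))%N.
Proof.
case: x y => [i|i] [j|j] /=; rewrite ?dim_rV0 ?sp_dimB //.
rewrite /framing_bimodule; case: eqP => [e|]; last by rewrite dim_rV0.
case: j / e => /=; rewrite mul1n (lcmn_idPl (dvdnn _)); exact: sp_dimD.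
Qed.

Definition framed_species : species k (framed_quiver Q) :=
  Species framed_dimD framed_dimB.

End FramedSpecies.

Section Modules.
Variables (k : finFieldType) (I : finType) (Q : vquiver I) (S : species k Q).

Local Notation D := (sp_D S).
Local Notation B := (sp_B S).

(* A left module over the tensor algebra T_R(N), where R is the product of the
   D i and N the sum of the B i j, is a k-space with a k-algebra map from R and
   an R-bimodule map from N to its endomorphisms. *)
Record smod := SMod {
  sm_sort :> vectType k;
  sm_D : forall i, 'Hom(D i, 'End(sm_sort));
  sm_B : forall i j, 'Hom(B i j, 'End(sm_sort));
  sm_DM : forall i a b x, sm_D i (a * b) x = sm_D i a (sm_D i b x);
  sm_D_orth : forall i j a b x, i != j -> sm_D i a (sm_D j b x) = 0;
  sm_D1 : forall x, \sum_i sm_D i 1 x = x;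
  sm_Bl : forall i j (a : D j) (b : B i j) x,
    sm_B i j (bim_l (B i j) a b) x = sm_D j a (sm_B i j b x);
  sm_Br : forall i j (a : D i) (b : B i j) x,
    sm_B i j (bim_r (B i j) a b) x = sm_B i j b (sm_D i a x)
}.

Implicit Types L M N P : smod.

Definition is_hom M N (f : 'Hom(M, N)) : Prop :=
  (forall i (a : D i) x, f (sm_D M i a x) = sm_D N i a (f x)) /\
  (forall i j (b : B i j) x, f (sm_B M i j b x) = sm_B N i j b (f x)).

Definition dcomm M N i (a : D i) (f : 'Hom(M, N)) : 'Hom(M, N) :=
  (f \o sm_D M i a)%VF - (sm_D N i a \o f)%VF.
Definition bcomm M N i j (b : B i j) (f : 'Hom(M, N)) : 'Hom(M, N) :=
  (f \o sm_B M i j b)%VF - (sm_B N i j b \o f)%VF.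

Definition homsp M N : {vspace 'Hom(M, N)} :=
  ((\bigcap_(i : I) \bigcap_(a <- vbasis {:D i}) lker (linfun (@dcomm M N i a)))
   :&: \bigcap_(i : I) \bigcap_(j : I) \bigcap_(b <- vbasis {:B i j})
          lker (linfun (@bcomm M N i j b)))%VS.

Lemma memv_bigcap (T : Type) (V : vectType k) (r : seq T) (F : T -> {vspace V}) x :
  (x \in (\bigcap_(t <- r) F t)%VS) = all (fun t => x \in F t) r.
Proof.
by elim: r => [|t r IH] /=; rewrite ?big_nil ?memvf // big_cons memv_cap IH.
Qed.

Lemma dcommE M N i a (f : 'Hom(M, N)) x :
  dcomm a f x = f (sm_D M i a x) - sm_D N i a (f x).
Proof. by rewrite /dcomm add_lfunE opp_lfunE !comp_lfunE. Qed.

Lemma bcommE M N i j b (f : 'Hom(M, N)) x :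
  bcomm b f x = f (sm_B M i j b x) - sm_B N i j b (f x).
Proof. by rewrite /bcomm add_lfunE opp_lfunE !comp_lfunE. Qed.

Lemma dcomm_linear M N i a : linear (@dcomm M N i a).
Proof.
move=> c f g; apply/lfunP => x.
rewrite !(dcommE, add_lfunE, scale_lfunE) linearP scalerBr opprD.
by rewrite [LHS]addrACA.
Qed.
HB.instance Definition _ M N i a := GRing.isLinear.Build k 'Hom(M, N) 'Hom(M, N)
  *:%R (@dcomm M N i a) (@dcomm_linear M N i a).

Lemma bcomm_linear M N i j b : linear (@bcomm M N i j b).
Proof.
move=> c f g; apply/lfunP => x.
rewrite !(bcommE, add_lfunE, scale_lfunE) linearP scalerBr opprD.
by rewrite [LHS]addrACA.
Qed.
HB.instance Definition _ M N i j b := GRing.isLinear.Build k 'Hom(M, N) 'Hom(M, N)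
  *:%R (@bcomm M N i j b) (@bcomm_linear M N i j b).

Lemma vbasis_ind (V W : vectType k) (f g : V -> W) :
  linear f -> linear g -> (forall t, t \in vbasis {:V} -> f t = g t) -> f =1 g.
Proof.
move=> lf lg h x.
pose F := HB.pack_for {linear V -> W} f (GRing.isLinear.Build k V W *:%R f lf).
pose G := HB.pack_for {linear V -> W} g (GRing.isLinear.Build k V W *:%R g lg).
rewrite (coord_vbasis (memvf x)) -[f]/(F : V -> W) -[g]/(G : V -> W).
rewrite !linear_sum; apply: eq_bigr => i _; rewrite !linearZ /= h //.
by rewrite mem_nth ?size_tuple.
Qed.

Lemma dcomm0P M N i (f : 'Hom(M, N)) :
  (forall (a : D i) x, f (sm_D M i a x) = sm_D N i a (f x)) <->
  (forall a : D i, a \in vbasis {:D i} -> dcomm a f = 0).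
Proof.
split=> [h a _|h a x]; first by apply/lfunP => x; rewrite dcommE h subrr zero_lfunE.
move: a; apply: vbasis_ind => [c a b|c a b|a /h /lfunP/(_ x)].
- by rewrite linearP add_lfunE scale_lfunE linearP.
- by rewrite linearP add_lfunE scale_lfunE.
- by rewrite dcommE zero_lfunE => /eqP; rewrite subr_eq0 => /eqP.
Qed.

Lemma bcomm0P M N i j (f : 'Hom(M, N)) :
  (forall (b : B i j) x, f (sm_B M i j b x) = sm_B N i j b (f x)) <->
  (forall b : B i j, b \in vbasis {:B i j} -> bcomm b f = 0).
Proof.
split=> [h a _|h a x]; first by apply/lfunP => x; rewrite bcommE h subrr zero_lfunE.
move: a; apply: vbasis_ind => [c a b|c a b|a /h /lfunP/(_ x)].
- by rewrite linearP add_lfunE scale_lfunE linearP.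
- by rewrite linearP add_lfunE scale_lfunE.
- by rewrite bcommE zero_lfunE => /eqP; rewrite subr_eq0 => /eqP.
Qed.

Lemma homspP M N (f : 'Hom(M, N)) : f \in homsp M N <-> is_hom f.
Proof.
rewrite /homsp memv_cap !memv_bigcap; split.
  move=> /andP[/allP hD /allP hB]; split=> [i|i j].
    apply/dcomm0P => a ha; have := hD i (mem_index_enum i).
    by rewrite memv_bigcap => /allP/(_ a ha); rewrite memv_ker lfunE => /eqP.
  apply/bcomm0P => b hb; have := hB i (mem_index_enum i).
  rewrite memv_bigcap => /allP/(_ j (mem_index_enum j)).
  by rewrite memv_bigcap => /allP/(_ b hb); rewrite memv_ker lfunE => /eqP.
move=> [hD hB]; apply/andP; split; apply/allP => i _.
  rewrite memv_bigcap; apply/allP => a ha; rewrite memv_ker lfunE /=.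
  by apply/eqP; move: a ha; apply/dcomm0P.
rewrite memv_bigcap; apply/allP => j _; rewrite memv_bigcap; apply/allP => b hb.
by rewrite memv_ker lfunE /=; apply/eqP; move: b hb; apply/bcomm0P.
Qed.

Definition is_submod M (U : {vspace M}) : Prop :=
  (forall i (a : D i), (sm_D M i a @: U <= U)%VS) /\
  (forall i j (b : B i j), (sm_B M i j b @: U <= U)%VS).

(* The i-th entry of the dimension vector of U is dim_{D i} (e_i U), where e_i
   is the unit of D i. *)
Definition dimv M (U : {vspace M}) (i : I) : nat :=
  (\dim (sm_D M i 1 @: U) %/ \dim {:D i})%N.

Definition indecomposable M : Prop :=
  (0 < \dim {:M})%N /\
  forall U W : {vspace M}, is_submod U -> is_submod W ->
    (U + W)%VS = fullv -> (U :&: W)%VS = 0%VS -> U = 0%VS \/ W = 0%VS.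

Definition maximal_submod M (U : {vspace M}) : Prop :=
  [/\ is_submod U, U <> fullv &
      forall W, is_submod W -> (U <= W)%VS -> W = U \/ W = fullv].

(* M is a finite set, so it has finitely many subspaces. *)
Definition radm M : {vspace M} :=
  (\bigcap_(W <- fset_set [set W : {vspace M} | maximal_submod W]) W)%VS.

Definition is_top M N : Prop :=
  exists f : 'Hom(M, N), [/\ is_hom f, limg f = fullv & lker f = radm M].

Definition Gr M (e : I -> nat) : set {vspace M} :=
  [set U | is_submod U /\ dimv U =1 e].

Definition projective (P : smod) : Prop :=
  forall M N (g : 'Hom(M, N)) (f : 'Hom(P, N)),
    is_hom g -> limg g = fullv -> is_hom f ->
    exists2 h : 'Hom(P, M), is_hom h & (g \o h)%VF = f.

Definition short_exact L M N (f : 'Hom(L, M)) (g : 'Hom(M, N)) : Prop :=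
  [/\ is_hom f, is_hom g, lker f = 0%VS, limg f = lker g & limg g = fullv].

Definition zero_smod : smod :=
  @SMod 'rV[k]_0 (fun _ => 0) (fun _ _ => 0) (fun _ _ _ _ => rV0_eq _ _)
    (fun _ _ _ _ _ _ => rV0_eq _ _) (fun _ => rV0_eq _ _)
    (fun _ _ _ _ _ => rV0_eq _ _) (fun _ _ _ _ _ => rV0_eq _ _).

Definition simple_D (i j : I) : 'Hom(D j, 'End(D i)) :=
  match j =P i with
  | ReflectT e => ecast z 'Hom(D j, 'End(D z)) e (lmulD (D j))
  | ReflectF _ => 0
  end.

Lemma simple_Dii i a x : simple_D i i a x = a * x.
Proof. by rewrite /simple_D; case: eqP => // e; rewrite eq_axiomK lmulDE. Qed.

Lemma simple_Dij i j a x : j != i -> simple_D i j a x = 0.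
Proof. by rewrite /simple_D; case: eqP => // _ _; rewrite !zero_lfunE. Qed.

Fact simple_DM s i (a b : D i) (x : D s) :
  simple_D s i (a * b) x = simple_D s i a (simple_D s i b x).
Proof.
have [e|ne] := eqVneq i s; last by rewrite !simple_Dij.
by case: s / e x => x; rewrite !simple_Dii mulrA.
Qed.

Fact simple_D_orth s i j (a : D i) (b : D j) (x : D s) :
  i != j -> simple_D s i a (simple_D s j b x) = 0.
Proof.
move=> ij; have [e|ne] := eqVneq j s; last by rewrite (simple_Dij _ _ ne) linear0.
by rewrite [LHS]simple_Dij // -e.
Qed.

Fact simple_D1 s (x : D s) : \sum_i simple_D s i 1 x = x.
Proof.
rewrite (bigD1 s) //= big1 ?addr0 ?simple_Dii ?mul1r // => i ne.
by rewrite simple_Dij.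
Qed.

Fact simple_B s i j (a : D j) (b : B i j) (x : D s) :
  (0 : 'Hom(B i j, 'End(D s))) (bim_l (B i j) a b) x =
  simple_D s j a ((0 : 'Hom(B i j, 'End(D s))) b x).
Proof. by rewrite !zero_lfunE linear0. Qed.

Fact simple_Br s i j (a : D i) (b : B i j) (x : D s) :
  (0 : 'Hom(B i j, 'End(D s))) (bim_r (B i j) a b) x =
  (0 : 'Hom(B i j, 'End(D s))) b (simple_D s i a x).
Proof. by rewrite !zero_lfunE. Qed.

Definition simple_smod (i : I) : smod :=
  @SMod (D i) (simple_D i) (fun _ _ => 0) (@simple_DM i) (@simple_D_orth i)
    (@simple_D1 i) (@simple_B i) (@simple_Br i).

Record presentation M := Presentation {
  pr_ker : smod;
  pr_cov : smod;
  pr_i : 'Hom(pr_ker, pr_cov);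
  pr_p : 'Hom(pr_cov, M);
  pr_projP : projective pr_cov;
  pr_exact : short_exact pr_i pr_p
}.

Lemma pr_iP M (r : presentation M) : is_hom (pr_i r).
Proof. by case: (pr_exact r). Qed.

Definition precomp L M N (g : 'Hom(L, M)) (f : 'Hom(M, N)) : 'Hom(L, N) :=
  (f \o g)%VF.

Lemma precomp_linear L M N g : linear (@precomp L M N g).
Proof. by move=> c f h; rewrite /precomp comp_lfunDl comp_lfunZl. Qed.
HB.instance Definition _ L M N g :=
  GRing.isLinear.Build k 'Hom(M, N) 'Hom(L, N) *:%R (@precomp L M N g)
    (@precomp_linear L M N g).

(* dim_k of Ext^1(M, N) = coker (Hom(P, N) -> Hom(Omega, N)), computed from a
   projective presentation 0 -> Omega -> P -> M -> 0. *)
Definition ext1_via M N (r : presentation M) : nat :=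
  (\dim (homsp (pr_ker r) N) -
   \dim (linfun (@precomp _ _ N (pr_i r)) @: homsp (pr_cov r) N)%VS)%N.

(* Independent of the presentation; one always exists when Q is acyclic, so that
   the default value is not reached. *)
Definition ext1 M N : nat :=
  xget 0%N [set d | exists r : presentation M, d = ext1_via N r].

Definition rigid M : Prop := ext1 M M = 0%N.

Record min_resolution M := MinResolution {
  mr_pres :> presentation M;
  mr_kerP : projective (pr_ker mr_pres);
  mr_min : (limg (pr_i mr_pres) <= radm (pr_cov mr_pres))%VS
}.

Record projmod := ProjMod { pm_mod :> smod; pm_projP : projective pm_mod }.

Lemma is_hom0 M N : is_hom (0 : 'Hom(M, N)).
Proof. by split=> *; rewrite !zero_lfunE linear0. Qed.

Lemma is_hom1 M : is_hom (\1%VF : 'Hom(M, M)).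
Proof. by split=> *; rewrite !id_lfunE. Qed.

Fact zero_projective : projective zero_smod.
Proof.
move=> M N g f _ _ _; exists 0; first exact: is_hom0.
by apply/lfunP => x; rewrite (rV0_eq x 0) !linear0.
Qed.

Definition zero_projmod : projmod := ProjMod zero_projective.

Record C2 := MkC2 {
  c2_src : projmod;
  c2_tgt : projmod;
  c2_d : 'Hom(c2_src, c2_tgt);
  c2_dP : is_hom c2_d
}.

Definition conflation (X Y Z : C2) : Prop :=
  exists (f1 : 'Hom(c2_src X, c2_src Y)) (f0 : 'Hom(c2_tgt X, c2_tgt Y))
         (g1 : 'Hom(c2_src Y, c2_src Z)) (g0 : 'Hom(c2_tgt Y, c2_tgt Z)),
    [/\ short_exact f1 g1, short_exact f0 g0,
        (f0 \o c2_d X)%VF = (c2_d Y \o f1)%VF &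
        (g0 \o c2_d Y)%VF = (c2_d Z \o g1)%VF].

(* K(C_2(P)) by generators and relations: a list of pairs stands for a formal
   Z-linear combination of objects, and K0eq is equality in the quotient of the
   free abelian group by the relations [Y] = [X] + [Z]. There is no zmodType on
   these objects: they live in a universe above that of eqType. *)
Definition K0term := seq (int * C2).

Inductive K0eq : K0term -> K0term -> Prop :=
  | K0eq_refl s : K0eq s s
  | K0eq_sym s t : K0eq s t -> K0eq t s
  | K0eq_trans s t u : K0eq s t -> K0eq t u -> K0eq s u
  | K0eq_cat s s' t t' : K0eq s s' -> K0eq t t' -> K0eq (s ++ t) (s' ++ t')
  | K0eq_comm s t : K0eq (s ++ t) (t ++ s)
  | K0eq_zero X : K0eq [:: (0, X)] [::]
  | K0eq_add a b X : K0eq [:: (a + b, X)] [:: (a, X); (b, X)]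
  | K0eq_ses X Y Z : conflation X Y Z -> K0eq [:: (1, Y)] [:: (1, X); (1, Z)].

Definition K_obj (P : projmod) : C2 := @MkC2 P P \1%VF (is_hom1 P).

Definition Z_obj (P : projmod) : C2 :=
  @MkC2 P zero_projmod 0 (is_hom0 P zero_projmod).

Definition C_proj (P : projmod) : C2 :=
  @MkC2 zero_projmod P 0 (is_hom0 zero_projmod P).

Definition C_obj M (r : min_resolution M) : C2 :=
  @MkC2 (ProjMod (@mr_kerP M r)) (ProjMod (@pr_projP M r)) (pr_i r) (pr_iP r).

End Modules.

Arguments Gr {k I Q S} M e.

Section Index.
Variables (k : finFieldType) (n : nat) (Q : vquiver 'I_n) (S : species k Q).
Variable Pi : 'I_n -> projmod S.

Definition K0comb (h : 'cV[int]_(n + n)) : K0term S :=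
  [seq (h (lshift n i) 0, C_proj (Pi i)) | i <- enum 'I_n] ++
  [seq (h (rshift n i) 0, K_obj (Pi i)) | i <- enum 'I_n].

(* When the Pi i are the indecomposable projectives, the classes in K0comb form a
   basis of K(C_2(P)): h exists and is unique. *)
Definition K0coords (X : C2 S) : 'cV[int]_(n + n) :=
  xget 0 [set h | K0eq [:: (1, X)] (K0comb h)].

Definition indo (X : C2 S) : 'cV[int]_n := usubmx (K0coords X).

End Index.

Section QuantumCharacter.
Variables (k : finFieldType) (n : nat) (Q : vquiver 'I_n) (S : species k Q).

(* The simple modules of the framed species; vertex n + i is inr i. *)
Definition fsimple (i : 'I_(n + n)) : smod (framed_species S) :=
  simple_smod (framed_species S) (fintype.split i).

(* Dimensions over a division algebra are quotients of dimensions over k. *)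
Definition Rt : 'M[int]_(n + n, n) := \matrix_(i, j)
  (ext1 (fsimple (lshift n j)) (fsimple i)
     %/ \dim (homsp (fsimple i) (fsimple i)))%N%:Z.

Definition Rt' : 'M[int]_(n + n, n) := \matrix_(i, j)
  (ext1 (fsimple i) (fsimple (lshift n j))
     %/ \dim (homsp (fsimple i) (fsimple i)))%N%:Z.

Definition It : 'M[int]_(n + n, n) := lsubmx (1%:M : 'M[int]_(n + n)).
Definition Bt : 'M[int]_(n + n, n) := Rt' - Rt.
Definition Et : 'M[int]_(n + n, n) := It - Rt'.
Definition Bmat : 'M[int]_n := usubmx Bt.

Definition euler_simple (i j : 'I_n) : int :=
  (\dim (homsp (simple_smod S i) (simple_smod S j)))%:Z -
  (ext1 (simple_smod S i) (simple_smod S j))%:Z.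

(* The Euler form dim Hom - dim Ext^1, extended bilinearly from the basis of
   K(A) given by the simple modules. *)
Definition euler (x y : 'cV[int]_n) : int :=
  \sum_i \sum_j x i 0 * y j 0 * euler_simple i j.

Definition dimvec (M : smod S) (U : {vspace M}) : 'cV[int]_n :=
  \col_i (dimv U i)%:Z.
Definition dvec (M : smod S) : 'cV[int]_n := dimvec (fullv : {vspace M}).

Definition top_vec (P : smod S) : 'cV[int]_(n + n) :=
  col_mx (dvec P - dimvec (radm P)) 0.

Variable L : 'M[int]_(n + n).

(* X_{M + P[1]}; the sum is over 0 <= e <= dim M, the other Grassmannians being
   empty. *)
Definition Xchar (M : smod S) (P : projmod S) : qtorus k L :=
  \sum_(e : {dffun forall i : 'I_n, 'I_(dimv (fullv : {vspace M}) i).+1})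
    let ev : 'cV[int]_n := \col_i (e i : nat)%:Z in
    (vpow k (euler (dvec P - ev) (dvec M - ev))
       * #|` fset_set (Gr M (fun i => e i : nat))|%:R)
    *: Xmon k L (- Bt *m ev - Et *m dvec M + top_vec P).

Definition X_mod (M : smod S) : qtorus k L := Xchar M (zero_projmod S).
Definition X_shift (P : projmod S) : qtorus k L := Xchar (zero_smod S) P.

Definition qdeg (a : 'cV[int]_(n + n)) : 'cV[int]_n :=
  usubmx a - Bmat *m dsubmx a.

Definition homogeneous (z : qtorus k L) (g : 'cV[int]_n) : Prop :=
  forall a, a \in msupp z -> qdeg a = g.

(* The degree of a nonzero homogeneous element is unique. *)
Definition gvec (z : qtorus k L) : 'cV[int]_n :=
  xget 0 [set g | z <> 0 /\ homogeneous z g].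

End QuantumCharacter.

(* Main.v *)
From HB Require Import structures.
From mathcomp Require Import all_boot all_order all_algebra all_field.
From mathcomp Require Import finmap boolp classical_sets cardinality monalg ring.
Require Import Defs.

Set Implicit Arguments.
Unset Strict Implicit.
Unset Printing Implicit Defensive.

Import GRing.Theory Num.Theory.
Local Open Scope ring_scope.

(** Let R be the upper block of the matrix of the numbers
    dim_{D_i} Ext^1(S_j, S_i). Each of the two equations holds because both
    sides can be read off from the vectors x - R x, for x a dimension vector.

    On the character side, the lower block of the exchange matrix is the
    identity, so the grading annihilates the contribution of e to the exponent
    of the e-th monomial ([qdeg_exponent]). Hence X_{M + P[1]} is homogeneous of
    degree dim (P / rad P) - (m - R m), where m is the dimension vector of M. It
    is nonzero, because the lower half of the exponent determines e and the
    coefficient at e = 0 counts the zero submodule ([gvec_Xchar]).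

    On the side of the index, send a complex to x - R x, where x is the
    dimension vector of its target minus that of its source. This is additive on
    conflations and kills every K_P. It takes C_{P_i} to the i-th basis vector,
    once the relation

        (1 - R) dim P = dim P - dim (rad P)   for P projective

    ([dvec_radm]) is known. As the classes of the C_{P_i} and K_{P_i} generate
    the Grothendieck group ([combination_obj]), this additive function is the
    index ([indo_C2_defect]). On C_M it takes the value m - R m, and on Z_P the
    value - (dim P - R dim P), which are the opposites of the degrees above.

    The relation expresses that the tensor algebra is hereditary: multiplication
    is an isomorphism from the sum over j of B_jl (x) P_j onto the l-part of
    rad P. Tensor products are avoided as follows. For P projective, every
    cocycle psi on P is solved by some f with f(b x) = b f(x) + psi(b, x)
    ([projective_cocycle]), since the extension defined by psi splits. Applied to
    cocycles built from linear functionals on P, this separates the products b x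
    enough to count dimensions ([dim_arrows_into]). What remains is to identify
    R with the dimensions of the bimodules ([ext1_simple]): the Ext group
    computed from any presentation of S_j has the right dimension, by the same
    splitting argument, and a presentation exists because a cyclic module of
    largest dimension at a given vertex is free ([free_cyclic]). *)

(** * Linear algebra *)

(** Actions on modules are stored in iterated Hom spaces; this is how a bilinear map
    written as a plain function becomes an element of one. *)
Definition bilin (k : fieldType) (U V W : vectType k) (F : U -> V -> W)
  (hl : forall v, linear (F^~ v)) (hr : forall u, linear (F u)) :
  {G : 'Hom(U, 'Hom(V, W)) | forall u v, G u v = F u v}.
Proof.
pose Fl u := HB.pack_for {linear V -> W} (F u) (GRing.isLinear.Build k V W *:%R (F u) (hr u)).
pose G0 u : 'Hom(V, W) := linfun (Fl u).
have lG : linear G0.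
  move=> a u v; apply/lfunP => x.
  by rewrite add_lfunE scale_lfunE !lfunE /= (hl x a u v).
pose Gl := HB.pack_for {linear U -> 'Hom(V, W)} G0 (GRing.isLinear.Build k U 'Hom(V, W) *:%R G0 lG).
by exists (linfun Gl) => u v; rewrite !lfunE.
Qed.

Definition lin_lfun (k : fieldType) (V W : vectType k) (f : V -> W) (hf : linear f) :
  {g : 'Hom(V, W) | forall v, g v = f v}.
Proof.
pose F := HB.pack_for {linear V -> W} f (GRing.isLinear.Build k V W *:%R f hf).
by exists (linfun F) => v; rewrite lfunE.
Qed.

Section EvaluationMap.
Variables (k : fieldType) (U V W : vectType k).
Implicit Type F : 'Hom(U, 'Hom(V, W)).

Fact eval_at_linear F y : linear (fun u => F u y).
Proof. by move=> c u v; rewrite linearP add_lfunE scale_lfunE. Qed.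

Definition eval_at F y : 'Hom(U, W) := sval (lin_lfun (eval_at_linear F y)).

Lemma eval_atE F y u : eval_at F y u = F u y.
Proof. by rewrite /eval_at; case: lin_lfun. Qed.

End EvaluationMap.

Lemma vspace_finite (k : finFieldType) (V : vectType k) (A : set {vspace V}) :
  finite_set A.
Proof.
apply: sub_finite_set (@subsetT _ A) _.
have -> : [set: {vspace V}]%classic =
    (@VectorInternalTheory.mx2vs _ V _ @` [set: 'M[k]_(dim V)])%classic.
  apply/seteqP; split=> // U _; exists (VectorInternalTheory.vs2mx U) => //.
  by rewrite VectorInternalTheory.vs2mxK.
exact: finite_image finite_finset.
Qed.

(** * Subspaces stable under the vertex fields *)

Section StableSubspaces.
Variables (k : finFieldType) (I : finType) (Q : vquiver I) (S : species k Q).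
Local Notation D := (sp_D S).
Local Notation B := (sp_B S).
Local Notation smod := (smod S).
Implicit Types L M N P : smod.

Lemma D1D M i (a : D i) (x : M) : sm_D M i 1 (sm_D M i a x) = sm_D M i a x.
Proof. by rewrite -sm_DM mul1r. Qed.

Lemma D1B M i j (b : B i j) (x : M) : sm_D M j 1 (sm_B M i j b x) = sm_B M i j b x.
Proof. by rewrite -sm_Bl bim_l1. Qed.

Lemma BD1 M i j (b : B i j) (x : M) : sm_B M i j b (sm_D M i 1 x) = sm_B M i j b x.
Proof. by rewrite -sm_Br bim_r1. Qed.

Lemma DB_orth M i j l (a : D l) (b : B i j) (x : M) :
  l != j -> sm_D M l a (sm_B M i j b x) = 0.
Proof. by move=> lj; rewrite -D1B sm_D_orth. Qed.

Lemma BD_orth M i j l (a : D l) (b : B i j) (x : M) :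
  l != i -> sm_B M i j b (sm_D M l a x) = 0.
Proof. by move=> li; rewrite -BD1 sm_D_orth ?linear0 // eq_sym. Qed.

Definition Dstable M (U : {vspace M}) : Prop :=
  forall i (a : D i) x, x \in U -> sm_D M i a x \in U.

Definition Bstable M (U : {vspace M}) : Prop :=
  forall i j (b : B i j) x, x \in U -> sm_B M i j b x \in U.

Lemma submodP M (U : {vspace M}) : is_submod U <-> Dstable U /\ Bstable U.
Proof.
split=> -[hD hB]; split.
- by move=> i a x xU; apply: subvP (hD i a) _ _; apply: memv_img.
- by move=> i j b x xU; apply: subvP (hB i j b) _ _; apply: memv_img.
- by move=> i a; apply/subvP => _ /memv_imgP[x xU ->]; apply: hD.
- by move=> i j b; apply/subvP => _ /memv_imgP[x xU ->]; apply: hB.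
Qed.

Definition Dhom M N (f : 'Hom(M, N)) : Prop :=
  forall i (a : D i) x, f (sm_D M i a x) = sm_D N i a (f x).

Lemma is_hom_Dhom M N (f : 'Hom(M, N)) : is_hom f -> Dhom f.
Proof. by case. Qed.

Lemma Dstable0 M : Dstable (0%VS : {vspace M}).
Proof. by move=> i a x; rewrite !memv0 => /eqP->; rewrite linear0. Qed.

Lemma Dstablef M : Dstable (fullv : {vspace M}).
Proof. by move=> i a x _; apply: memvf. Qed.

Lemma Dstable_add M (U W : {vspace M}) : Dstable U -> Dstable W -> Dstable (U + W)%VS.
Proof.
move=> hU hW i a x /memv_addP[u uU [w wW ->]].
by rewrite linearD memv_add ?hU ?hW.
Qed.

Lemma Dstable_cap M (U W : {vspace M}) : Dstable U -> Dstable W -> Dstable (U :&: W)%VS.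
Proof. by move=> hU hW i a x; rewrite !memv_cap => /andP[/hU-> /hW->]. Qed.

Lemma Dstable_ker M N (f : 'Hom(M, N)) : Dhom f -> Dstable (lker f).
Proof. by move=> hf i a x; rewrite !memv_ker hf => /eqP->; rewrite linear0. Qed.

Lemma Dstable_img M N (f : 'Hom(M, N)) (U : {vspace M}) :
  Dhom f -> Dstable U -> Dstable (f @: U)%VS.
Proof. by move=> hf hU i a _ /memv_imgP[x xU ->]; rewrite -hf memv_img ?hU. Qed.

Definition Dline_map M i (y : M) : 'Hom(D i, M) := eval_at (sm_D M i) y.

Lemma Dline_mapE M i (y : M) d : Dline_map i y d = sm_D M i d y.
Proof. exact: eval_atE. Qed.

Definition Dline M i (y : M) : {vspace M} := limg (Dline_map i y).

Lemma DlineP M i (y : M) x : reflect (exists d, x = sm_D M i d y) (x \in Dline i y).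
Proof.
apply: (iffP memv_imgP) => [[d _ ->]|[d ->]]; exists d; rewrite ?Dline_mapE ?memvf //.
Qed.

Lemma memv_Dline M i (y : M) d : sm_D M i d y \in Dline i y.
Proof. by apply/DlineP; exists d. Qed.

Lemma Dstable_Dline M i (y : M) : Dstable (Dline i y).
Proof.
move=> j a _ /DlineP[d ->]; have [e|ne] := eqVneq j i.
  by case: i / e y d => y d; rewrite -sm_DM memv_Dline.
by rewrite sm_D_orth ?mem0v.
Qed.

Lemma DV M i (d : D i) (x : M) : d != 0 -> sm_D M i d^-1 (sm_D M i d x) = sm_D M i 1 x.
Proof. by move=> d0; rewrite -sm_DM mulVf. Qed.

(** D_i is a field, so a nonzero multiple of y in W would bring y itself into W. *)
Lemma Dline_cap M i (y : M) (W : {vspace M}) : Dstable W -> sm_D M i 1 y = y ->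
  y \notin W -> (Dline i y :&: W = 0)%VS.
Proof.
move=> hW ey yW; apply/eqP; rewrite -subv0; apply/subvP => x.
rewrite memv_cap memv0 => /andP[/DlineP[d ->] xW].
have [->|d0] := eqVneq d 0; first by rewrite linear0 zero_lfunE.
by case/negP: yW; rewrite -ey -(DV _ d0) hW.
Qed.

Lemma Dline_map_ker M i (y : M) : sm_D M i 1 y = y -> y != 0 -> lker (Dline_map i y) == 0%VS.
Proof.
move=> ey y0; rewrite -subv0; apply/subvP => d; rewrite memv_ker Dline_mapE memv0 => dy.
apply: contraNT y0 => d0; rewrite -ey -(DV _ d0) (eqP dy) linear0 //.
Qed.

Lemma dim_Dline M i (y : M) : sm_D M i 1 y = y -> y != 0 -> \dim (Dline i y) = \dim {:D i}.
Proof.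
by move=> ey y0; rewrite limg_dim_eq // (eqP (Dline_map_ker ey y0)) capv0.
Qed.

Lemma memv_vertex_parts M (U : {vspace M}) x :
  (forall i, sm_D M i 1 x \in U) -> x \in U.
Proof. by move=> h; rewrite -(sm_D1 x) memv_suml. Qed.

(** Dimensions are bounded, so an increasing chain of subspaces stops. *)
Lemma max_vspace (V : vectType k) (A : {vspace V} -> Prop) (W : {vspace V}) : A W ->
  exists W', [/\ A W', (W <= W')%VS & forall U, A U -> (W' <= U)%VS -> U = W'].
Proof.
move: {2}(\dim {:V} - \dim W)%N (erefl (\dim {:V} - \dim W)%N) => m.
elim/ltn_ind: m W => m IH W hm hA.
have [[U [hU [WU ne]]]|no] := pselect (exists U, A U /\ (W <= U)%VS /\ U <> W); last first.
  exists W; split=> // U hU WU; apply: contrapT => ne; apply: no; exists U; split=> //.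
have lt : (\dim W < \dim U)%N.
  rewrite ltnNge; apply/negP => le; apply: ne; apply/eqP.
  by rewrite eq_sym eqEdim WU.
have [|W' [h1 h2 h3]] := IH (\dim {:V} - \dim U)%N _ U erefl hU.
  by rewrite -hm ltn_sub2l // (leq_trans lt) // dimvS // subvf.
by exists W'; split=> //; apply: subv_trans WU h2.
Qed.

(** A D-stable complement of the line D_i y. A D-stable W' containing W that is
    maximal among those avoiding y has this property. *)
Lemma Dstable_complement M (W : {vspace M}) i (y : M) :
  Dstable W -> sm_D M i 1 y = y -> y \notin W ->
  exists W', [/\ Dstable W', (W <= W')%VS, y \notin W' & (Dline i y + W' = fullv)%VS].
Proof.
move=> hW ey yW.
have [W' [[hD yW'] WW' mx]] :=
  max_vspace (A := fun U : {vspace M} => Dstable U /\ y \notin U) (conj hW yW).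
exists W'; split=> //; apply/eqP; rewrite eqEsubv subvf /=.
apply/subvP => x _; apply: memv_vertex_parts => j; set z := sm_D M j 1 x.
have [zW|zW] := boolP (z \in W'); first by rewrite (subvP (addvSr _ _)).
have ez : sm_D M j 1 z = z by rewrite /z D1D.
(* If W' + D_j z avoids y, then it equals W' by maximality and contains z.
   Otherwise y = d z + w with w in W', and y not in W' forces i = j and d != 0. *)
have [yz|yz] := boolP (y \in (Dline j z + W')%VS); last first.
  case/negP: zW; have <- : (Dline j z + W')%VS = W'.
    by apply: mx; rewrite ?addvSr //; split=> //; apply: Dstable_add => //; apply: Dstable_Dline.
  by rewrite (subvP (addvSl _ _)) // -{1}ez memv_Dline.
case/memv_addP: yz => _ /DlineP[d ->] [w wW' yE].
have [e|ne] := eqVneq i j; last first.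
  case/negP: yW'; rewrite -ey yE linearD /= (sm_D_orth _ _ _ ne) add0r; exact: hD.
case: j / e d z zW ez yE => d z zW ez yE.
have d0 : d != 0.
  by apply: contraNneq yW' => d0; rewrite yE d0 linear0 zero_lfunE add0r.
have -> : z = sm_D M i d^-1 y - sm_D M i d^-1 w by rewrite yE linearD /= DV // ez addrK.
by rewrite memv_add ?memv_Dline // memvN hD.
Qed.

(** Separation of a vector from a D-stable subspace by a functional that is linear
    over the vertex fields. The simple module S_i serves as the target because it
    carries the action of all vertex fields, the ones away from i acting by zero. *)
Lemma Dfunctional M (W : {vspace M}) i (y : M) :
  Dstable W -> sm_D M i 1 y = y -> y \notin W ->
  exists a : 'Hom(M, simple_smod S i), [/\ Dhom a, (W <= lker a)%VS & a y = 1].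
Proof.
move=> hW ey yW; have [W' [hW' WW' yW' full]] := Dstable_complement hW ey yW.
have cap : (Dline i y :&: W' = 0)%VS by apply: Dline_cap.
have y0 : y != 0 by apply: contraNneq yW' => ->; rewrite mem0v.
have K := Dline_map_ker ey y0.
pose pi := daddv_pi (Dline i y) W'.
have piW x : x \in W' -> pi x = 0.
  move=> xW; apply/eqP; rewrite -memv0 -cap memv_cap memv_pi /=.
  have xf : x \in (Dline i y + W')%VS by rewrite full memvf.
  have <- : x - daddv_pi W' (Dline i y) x = pi x.
    by apply/eqP; rewrite subr_eq -[X in X == _](daddv_pi_add cap xf).
  by rewrite memvB // memv_pi.
have piO d : pi (sm_D M i d y) = sm_D M i d y by rewrite /pi daddv_pi_id ?memv_Dline.
pose a : 'Hom(M, simple_smod S i) := ((Dline_map i y)^-1 \o pi)%VF.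
have aO d : a (sm_D M i d y) = d.
  by rewrite comp_lfunE piO -Dline_mapE lker0_lfunK.
have aW x : x \in W' -> a x = 0 by move=> xW; rewrite comp_lfunE piW ?linear0.
exists a; split=> [j c x||]; last by rewrite -{1}ey aO.
  have /memv_addP[_ /DlineP[d ->] [w wW ->]] : x \in (Dline i y + W')%VS by rewrite full memvf.
  rewrite !linearD /= (aW w) // (aW (sm_D M j c w)) ?hW' // linear0 !addr0 aO.
  have [/esym e|ne] := eqVneq j i; last by rewrite sm_D_orth // linear0 simple_Dij.
  by case: j / e c => c; rewrite -sm_DM aO simple_Dii.
by apply: subv_trans WW' _; apply/subvP => x xW; rewrite memv_ker aW.
Qed.

Lemma exists_vertex_vector M (U : {vspace M}) : Dstable U -> U <> 0%VS ->
  exists i (y : M), [/\ sm_D M i 1 y = y, y != 0 & y \in U].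
Proof.
move=> hU; apply: contra_notP => no; apply/eqP; rewrite -subv0; apply/subvP => x xU.
apply: memv_vertex_parts => i; rewrite memv0; apply: contra_notT no => nz.
by exists i, (sm_D M i 1 x); rewrite D1D hU.
Qed.

(** D-stable subspaces can be built up one line D_i y at a time. Statements about
    dimension vectors are proved along such a chain, without choosing bases over the
    vertex fields. *)
Lemma Dstable_ind M (Pr : {vspace M} -> Prop) :
  Pr 0%VS ->
  (forall W i y, Dstable W -> Pr W -> sm_D M i 1 y = y -> y \notin W ->
     Pr (W + Dline i y)%VS) ->
  forall U, Dstable U -> Pr U.
Proof.
move=> h0 hs U; move: {2}(\dim U) (erefl (\dim U)) => m.
elim/ltn_ind: m U => m IH U hm hU.
have [->//|/eqP U0] := eqVneq U 0%VS.
have [i [y [ey y0 yU]]] := exists_vertex_vector hU U0.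
have [|a [ha _ ay]] := Dfunctional (@Dstable0 M) ey; first by rewrite memv0.
(* U is the sum of U /\ ker a, of smaller dimension, and of the line D_i y. *)
pose W := (U :&: lker a)%VS.
have hW : Dstable W by apply: Dstable_cap => //; apply: Dstable_ker.
have yW : y \notin W by rewrite memv_cap memv_ker ay negb_and oner_eq0 orbT.
have <- : (W + Dline i y)%VS = U.
  apply/eqP; rewrite eqEsubv subv_add capvSl /=; apply/andP; split.
    by apply/subvP => _ /DlineP[d ->]; apply: hU.
  apply/subvP => x xU; rewrite -[x](subrK (sm_D M i (a x) y)).
  rewrite memv_add ?memv_Dline // memv_cap memvB ?hU //= memv_ker linearB /= ha ay.
  by rewrite simple_Dii mulr1 subrr.
apply: hs => //; apply: (IH (\dim W)) => //; rewrite -hm ltnNge; apply/negP => le.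
case/negP: yW; suff -> : W = U by [].
by apply/eqP; rewrite eqEdim capvSl.
Qed.

End StableSubspaces.

(** * Dimension vectors, submodules and extensions *)

Section DimensionVectors.
Variables (k : finFieldType) (I : finType) (Q : vquiver I) (S : species k Q).
Local Notation D := (sp_D S).
Local Notation B := (sp_B S).
Local Notation smod := (smod S).
Implicit Types L M N P : smod.

Definition vertex_part M (U : {vspace M}) i : {vspace M} := (sm_D M i 1 @: U)%VS.

Lemma vertex_partP M (U : {vspace M}) i x : Dstable U ->
  (x \in vertex_part U i) = (x \in U) && (sm_D M i 1 x == x).
Proof.
move=> hU; apply/memv_imgP/andP => [[y yU ->]|[xU /eqP ex]].
  by rewrite hU // D1D.
by exists x.
Qed.

Lemma vertex_part_img M N (f : 'Hom(M, N)) (U : {vspace M}) i :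
  Dhom f -> vertex_part (f @: U)%VS i = (f @: vertex_part U i)%VS.
Proof.
move=> hf; rewrite /vertex_part -!limg_comp; congr (_ @: _)%VS.
by apply/lfunP => x; rewrite !comp_lfunE hf.
Qed.

Lemma dim_vertex_part_img M N (f : 'Hom(M, N)) (U : {vspace M}) i : Dhom f -> Dstable U ->
  \dim (vertex_part U i) =
    (\dim (vertex_part (U :&: lker f)%VS i) + \dim (vertex_part (f @: U)%VS i))%N.
Proof.
move=> hf hU; rewrite vertex_part_img // -(limg_ker_dim f (vertex_part U i)); congr (\dim _ + _)%N.
apply/vspaceP => x; rewrite memv_cap !vertex_partP //; last first.
  by apply: Dstable_cap => //; apply: Dstable_ker.
by rewrite memv_cap andbAC.
Qed.

Lemma vertex_part0 M i : vertex_part (0%VS : {vspace M}) i = 0%VS.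
Proof. by rewrite /vertex_part limg0. Qed.

Lemma vertex_partD M (U W : {vspace M}) i :
  vertex_part (U + W)%VS i = (vertex_part U i + vertex_part W i)%VS.
Proof. by rewrite /vertex_part limgD. Qed.

Lemma vertex_part_Dline M i (y : M) : vertex_part (Dline i y) i = Dline i y.
Proof.
apply/vspaceP => x; rewrite vertex_partP; last exact: Dstable_Dline.
by apply/andP/idP => [[]//|xo]; split=> //; case/DlineP: xo => d ->; rewrite D1D.
Qed.

Lemma vertex_part_Dline_neq M i j (y : M) : j != i -> vertex_part (Dline i y) j = 0%VS.
Proof.
move=> ne; apply/eqP; rewrite -subv0; apply/subvP => x.
rewrite vertex_partP ?memv0; last exact: Dstable_Dline.
by move=> /andP[/DlineP[d ->] /eqP<-]; rewrite sm_D_orth.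
Qed.

Lemma dim_vertex_part_add_Dline M (W : {vspace M}) i j (y : M) :
  Dstable W -> sm_D M j 1 y = y -> y \notin W ->
  \dim (vertex_part (W + Dline j y)%VS i) = (\dim (vertex_part W i) + (i == j) * \dim {:D i})%N.
Proof.
move=> hW ey yW; rewrite vertex_partD.
have [->|ne] := eqVneq i j; last by rewrite vertex_part_Dline_neq // addv0 addn0.
rewrite vertex_part_Dline mul1n -(dim_Dline ey); last by apply: contraNneq yW => ->; rewrite mem0v.
rewrite dimv_disjoint_sum //; apply/eqP; rewrite -subv0 -(Dline_cap hW ey yW) capvC.
by rewrite capvS //; apply/subvP => x; rewrite vertex_partP // => /andP[].
Qed.

Lemma dimD_gt0 i : (0 < \dim {:D i})%N.
Proof. by rewrite sp_dimD vq_val_gt0. Qed.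

(** The division in the definition of the dimension vector is exact. *)
Lemma dim_vertex_part M (U : {vspace M}) i : Dstable U ->
  \dim (vertex_part U i) = (dimv U i * \dim {:D i})%N.
Proof.
move=> hU; suff: (\dim {:D i} %| \dim (vertex_part U i))%N by move=> /divnK.
move: U hU; apply: Dstable_ind => [|W j y hW h ey yW]; first by rewrite vertex_part0 dimv0 dvdn0.
by rewrite dim_vertex_part_add_Dline // dvdn_add // dvdn_mull.
Qed.

Lemma dimv_img M N (f : 'Hom(M, N)) (U : {vspace M}) i : Dhom f -> Dstable U ->
  dimv U i = (dimv (U :&: lker f)%VS i + dimv (f @: U)%VS i)%N.
Proof.
move=> hf hU; apply/eqP; rewrite -(eqn_pmul2r (dimD_gt0 i)) mulnDl -!dim_vertex_part //.
- by rewrite -dim_vertex_part_img.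
- exact: Dstable_img.
- by apply: Dstable_cap => //; apply: Dstable_ker.
Qed.

Lemma dimv_add_Dline M (W : {vspace M}) i j (y : M) :
  Dstable W -> sm_D M j 1 y = y -> y \notin W ->
  dimv (W + Dline j y)%VS i = (dimv W i + (i == j))%N.
Proof.
move=> hW ey yW; apply/eqP; rewrite -(eqn_pmul2r (dimD_gt0 i)) mulnDl -!dim_vertex_part //.
  by rewrite dim_vertex_part_add_Dline.
by apply: Dstable_add => //; apply: Dstable_Dline.
Qed.

Lemma dimv0E M i : dimv (0%VS : {vspace M}) i = 0%N.
Proof. by rewrite /dimv limg0 dimv0 div0n. Qed.

Lemma dimv_ses L M N (f : 'Hom(L, M)) (g : 'Hom(M, N)) i : short_exact f g ->
  dimv (fullv : {vspace M}) i =
    (dimv (fullv : {vspace L}) i + dimv (fullv : {vspace N}) i)%N.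
Proof.
move=> [hf hg kf e sg].
rewrite (dimv_img i (is_hom_Dhom hg) (@Dstablef _ _ _ _ M)) capfv -e sg; congr (_ + _)%N.
rewrite (dimv_img i (is_hom_Dhom hf) (@Dstablef _ _ _ _ L)) kf capv0 dimv0E add0n //.
Qed.

Section Sub.
Variables (M : smod) (U : {vspace M}) (hU : is_submod U).

Let sD i : {F : 'Hom(D i, 'End(subvs_of U)) | forall a x,
   F a x = vsproj U (sm_D M i a (vsval x))}.
Proof.
apply: bilin => [x|a] c u v.
  by rewrite linearP add_lfunE scale_lfunE linearP.
by rewrite !linearP.
Qed.

Let sB i j : {F : 'Hom(B i j, 'End(subvs_of U)) | forall a x,
   F a x = vsproj U (sm_B M i j a (vsval x))}.
Proof.
apply: bilin => [x|a] c u v.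
  by rewrite linearP add_lfunE scale_lfunE linearP.
by rewrite !linearP.
Qed.

Let sDE i a x : vsval (sval (sD i) a x) = sm_D M i a (vsval x).
Proof.
case: (sD i) => F /= ->; rewrite vsprojK //.
by case/submodP: hU => hD _; apply: hD; apply: subvsP.
Qed.

Let sBE i j b x : vsval (sval (sB i j) b x) = sm_B M i j b (vsval x).
Proof.
case: (sB i j) => F /= ->; rewrite vsprojK //.
by case/submodP: hU => _ hB; apply: hB; apply: subvsP.
Qed.

Definition submod_smod : smod.
Proof.
refine (@SMod k I Q S (subvs_of U) (fun i => sval (sD i)) (fun i j => sval (sB i j)) _ _ _ _ _).
- by move=> i a b x; apply: val_inj; rewrite /= !sDE sm_DM.
- by move=> i j a b x ij; apply: val_inj; rewrite /= !sDE sm_D_orth ?linear0.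
- move=> x; apply: val_inj => /=; rewrite linear_sum /= -[RHS]sm_D1.
  by apply: eq_bigr => i _; rewrite sDE.
- by move=> i j a b x; apply: val_inj; rewrite /= sDE !sBE sm_Bl.
- by move=> i j a b x; apply: val_inj; rewrite /= !sBE sDE sm_Br.
Defined.

Definition sub_incl : 'Hom(submod_smod, M) := linfun vsval.

Lemma sub_inclE x : sub_incl x = vsval x.
Proof. by rewrite lfunE. Qed.

Lemma sub_incl_hom : is_hom sub_incl.
Proof. by split=> *; rewrite !sub_inclE /= ?sDE ?sBE. Qed.

Lemma sub_incl_ker : lker sub_incl = 0%VS.
Proof.
apply/eqP/lker0P => x y; rewrite !sub_inclE; exact: val_inj.
Qed.

Lemma sub_incl_img : limg sub_incl = U.
Proof.
apply/vspaceP => x; apply/memv_imgP/idP => [[y _ ->]|xU]; first by rewrite sub_inclE subvsP.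
by exists (vsproj U x); rewrite ?memvf // sub_inclE vsprojK.
Qed.

Lemma sub_dim : \dim {:submod_smod} = \dim U.
Proof. by rewrite -sub_incl_img limg_dim_eq // sub_incl_ker capv0. Qed.

Lemma sub_factor N (f : 'Hom(N, M)) : is_hom f -> (limg f <= U)%VS ->
  exists2 g : 'Hom(N, submod_smod), is_hom g & (sub_incl \o g)%VF = f.
Proof.
move=> [fD fB] hf; have fU x : f x \in U by apply: subvP hf _ _; rewrite memv_img ?memvf.
pose g : 'Hom(N, submod_smod) := (linfun (vsproj U) \o f)%VF.
have gE x : vsval (g x) = f x by rewrite comp_lfunE lfunE /= vsprojK.
exists g; last by apply/lfunP => x; rewrite comp_lfunE sub_inclE gE.
split=> *; apply: val_inj; rewrite /= gE ?sDE ?sBE gE ?fD ?fB //.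
Qed.

End Sub.

(** The bimodule maps that measure the failure of an extension of M by N to be the
    direct sum: the arrows act on M + N by (x, y) |-> (b x, b y + psi(b, x)). *)
Definition cocycle M N (psi : forall i j, 'Hom(B i j, 'Hom(M, N))) : Prop :=
  (forall i j (a : D j) (b : B i j) x, psi i j (bim_l (B i j) a b) x = sm_D N j a (psi i j b x))
  /\ (forall i j (a : D i) (b : B i j) x, psi i j (bim_r (B i j) a b) x = psi i j b (sm_D M i a x)).

Section Ext.
Variables (M N : smod) (psi : forall i j, 'Hom(B i j, 'Hom(M, N))).
Hypothesis hpsi : cocycle psi.

Let eD i : {F : 'Hom(D i, 'End((M * N)%type)) | forall a x,
   F a x = (sm_D M i a x.1, sm_D N i a x.2)}.
Proof.
apply: bilin => [x|a] c u v.
  by rewrite !linearP !add_lfunE !scale_lfunE.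
by rewrite !linearP.
Qed.

Let eB i j : {F : 'Hom(B i j, 'End((M * N)%type)) | forall a x,
   F a x = (sm_B M i j a x.1, sm_B N i j a x.2 + psi i j a x.1)}.
Proof.
apply: bilin => [x|a] c u v.
  rewrite !linearP !add_lfunE !scale_lfunE; congr pair.
  by rewrite /= scalerDr addrACA.
by rewrite !linearP; congr pair; rewrite /= scalerDr addrACA.
Qed.

Let eDE i a x : sval (eD i) a x = (sm_D M i a x.1, sm_D N i a x.2).
Proof. by case: (eD i). Qed.
Let eBE i j a x : sval (eB i j) a x = (sm_B M i j a x.1, sm_B N i j a x.2 + psi i j a x.1).
Proof. by case: (eB i j). Qed.

Definition ext_smod : smod.
Proof.
refine (@SMod k I Q S (M * N)%type (fun i => sval (eD i)) (fun i j => sval (eB i j)) _ _ _ _ _).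
- by move=> i a b x; rewrite !eDE !sm_DM.
- by move=> i j a b x ij; rewrite !eDE !sm_D_orth.
- move=> [x y]; under eq_bigr do rewrite eDE /=.
  by apply: injective_projections; rewrite raddf_sum /= sm_D1.
- by move=> i j a b x; rewrite eDE !eBE /= !sm_Bl hpsi.1 linearD.
- by move=> i j a b x; rewrite eDE !eBE /= !sm_Br hpsi.2.
Defined.

Lemma ext_DE i a (x : ext_smod) : sm_D ext_smod i a x = (sm_D M i a x.1, sm_D N i a x.2).
Proof. exact: eDE. Qed.
Lemma ext_BE i j b (x : ext_smod) :
  sm_B ext_smod i j b x = (sm_B M i j b x.1, sm_B N i j b x.2 + psi i j b x.1).
Proof. exact: eBE. Qed.

End Ext.

(** The extension defined by the cocycle projects onto P, so it splits; f is the
    second component of a splitting. *)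
Lemma projective_cocycle P N (psi : forall i j, 'Hom(B i j, 'Hom(P, N))) :
  projective P -> cocycle psi ->
  exists2 f : 'Hom(P, N), Dhom f &
    forall i j (b : B i j) x, f (sm_B P i j b x) = sm_B N i j b (f x) + psi i j b x.
Proof.
move=> hP hpsi; pose E := ext_smod hpsi.
have [p1 p1E] := lin_lfun (V := E) (W := P) (f := fst) (fun _ _ _ => erefl).
have [p2 p2E] := lin_lfun (V := E) (W := N) (f := snd) (fun _ _ _ => erefl).
have [|||h [hD hB] e] := hP E P p1 \1%VF.
- by split=> *; rewrite !p1E ?ext_DE ?ext_BE.
- apply/eqP; rewrite eqEsubv subvf; apply/subvP => x _; apply/memv_imgP.
  by exists ((x, 0) : E); rewrite ?memvf ?p1E.
- exact: is_hom1.
have e1 x : (h x).1 = x by rewrite -p1E -comp_lfunE e id_lfunE.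
exists (p2 \o h)%VF => [i a x|i j b x]; rewrite !comp_lfunE !p2E.
  by rewrite hD ext_DE.
by rewrite hB ext_BE /= e1.
Qed.

End DimensionVectors.

(** * The radical of a module *)

Section Radical.
Variables (k : finFieldType) (I : finType) (Q : vquiver I) (S : species k Q).
Local Notation D := (sp_D S).
Local Notation B := (sp_B S).
Local Notation smod := (smod S).
Implicit Types L M N P : smod.

Section VertexModule.
Variables (l : I) (V : vectType k) (rho : 'Hom(D l, 'End(V))).
Hypotheses (rho1 : forall x, rho 1 x = x)
  (rhoM : forall a b x, rho (a * b) x = rho a (rho b x)).

Let vD : forall i, 'Hom(D i, 'End(V)) := dfwith (fun i => 0 : 'Hom(D i, 'End(V))) rho.

Definition vertex_smod : smod.
Proof.
refine (@SMod k I Q S V vD (fun _ _ => 0) _ _ _ _ _).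
- move=> i a b x; rewrite /vD; case: dfwithP a b => [a b|i' _ a b]; first exact: rhoM.
  by rewrite !zero_lfunE.
- move=> i j a b x ij; have [e|ne] := eqVneq l i.
    have lj : l != j by rewrite e.
    by rewrite /vD (dfwith_out _ _ lj) !zero_lfunE linear0.
  by rewrite {1}/vD (dfwith_out _ _ ne) !zero_lfunE.
- move=> x; rewrite (bigD1 l) //= /vD dfwith_in rho1 big1 ?addr0 // => i.
  by rewrite eq_sym => /(dfwith_out _ _) ->; rewrite !zero_lfunE.
- by move=> i j a b x; rewrite !zero_lfunE linear0.
- by move=> i j a b x; rewrite !zero_lfunE.
Defined.

Lemma vertex_Dl a (x : vertex_smod) : sm_D vertex_smod l a x = rho a x.
Proof. by rewrite /= /vD dfwith_in. Qed.

Lemma vertex_Dn i a (x : vertex_smod) : l != i -> sm_D vertex_smod i a x = 0.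
Proof. by move=> ne; rewrite /= /vD (dfwith_out _ _ ne) !zero_lfunE. Qed.

Lemma vertex_B i j b (x : vertex_smod) : sm_B vertex_smod i j b x = 0.
Proof. by rewrite /= !zero_lfunE. Qed.

End VertexModule.

Section ArrowCocycle.
Variables (M N : smod) (i j : I) (F : B i j -> M -> N).
Hypotheses (Fl : forall x, linear (F^~ x)) (Fr : forall b, linear (F b)).
Hypotheses (F_D : forall a b x, F (bim_l (B i j) a b) x = sm_D N j a (F b x))
  (F_bal : forall a b x, F (bim_r (B i j) a b) x = F b (sm_D M i a x)).

Let T (p : I * I) := 'Hom(B p.1 p.2, 'Hom(M, N)).
Let psi0 : forall p, T p := dfwith (fun p => 0 : T p) (i := (i, j)) (sval (bilin Fl Fr)).

(** A D-bilinear balanced pairing along a single arrow, extended by zero to the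
    other arrows, is a cocycle as soon as it takes values at the target vertex. *)
Lemma arrow_cocycle : exists psi : forall i j, 'Hom(B i j, 'Hom(M, N)),
  [/\ cocycle psi, forall b x, psi i j b x = F b x &
     forall i' j' b x, (i, j) != (i', j') -> psi i' j' b x = 0].
Proof.
exists (fun i' j' => psi0 (i', j')).
have E b x : psi0 (i, j) b x = F b x by rewrite /psi0 dfwith_in; case: bilin.
have Z i' j' (b : B i' j') x : (i, j) != (i', j') -> psi0 (i', j') b x = 0.
  by move=> ne; rewrite /psi0 (dfwith_out _ _ ne) !zero_lfunE.
split=> //; split=> i' j' a b x.
  have [e|ne] := eqVneq (i, j) (i', j'); last by rewrite !Z // linear0.
  by case: e a b => <- <- a b; rewrite !E.
have [e|ne] := eqVneq (i, j) (i', j'); last by rewrite !Z.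
by case: e a b => <- <- a b; rewrite !E.
Qed.

End ArrowCocycle.

Definition arrows_into M (U : {vspace M}) l : {vspace M} :=
  (\sum_j \sum_(b <- vbasis {:B j l}) (sm_B M j l b @: U))%VS.

Lemma arrows_intoS M (U W : {vspace M}) l :
  (forall j (b : B j l) x, x \in U -> sm_B M j l b x \in W) <-> (arrows_into U l <= W)%VS.
Proof.
split=> [h|h j b x xU].
  apply/subv_sumP => j _; rewrite big_tnth; apply/subv_sumP => b _.
  by apply/subvP => _ /memv_imgP[x xU ->]; apply: h.
rewrite (coord_vbasis (memvf b)) linear_sum sum_lfunE memv_suml // => i _.
rewrite linearZ scale_lfunE memvZ //; apply: subvP h _ _.
rewrite /arrows_into (bigD1 j) //=; apply: subvP (addvSl _ _) _ _.
have bi : (vbasis {:B j l})`_i \in vbasis {:B j l} by rewrite mem_nth ?size_tuple.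
by rewrite (big_rem _ bi) /=; apply: subvP (addvSl _ _) _ _; rewrite memv_img.
Qed.

Lemma mem_arrows_into M (U : {vspace M}) l j (b : B j l) x :
  x \in U -> sm_B M j l b x \in arrows_into U l.
Proof. by move=> xU; apply: (arrows_intoS U (arrows_into U l) l).2. Qed.

Definition arrow_map M i j (y : M) : 'Hom(B i j, M) := eval_at (sm_B M i j) y.

Lemma arrow_mapE M i j (y : M) b : arrow_map i j y b = sm_B M i j b y.
Proof. exact: eval_atE. Qed.

Lemma arrows_into_add_Dline M (W : {vspace M}) j l (y : M) : sm_D M j 1 y = y ->
  arrows_into (W + Dline j y)%VS l = (arrows_into W l + limg (arrow_map j l y))%VS.
Proof.
move=> ey; apply/eqP; rewrite eqEsubv subv_add; apply/and3P; split.
- apply/arrows_intoS => i b _ /memv_addP[w wW [_ /DlineP[d ->] ->]].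
  rewrite linearD memv_add ?mem_arrows_into //=.
  have [e|ne] := eqVneq j i; last by rewrite BD_orth ?mem0v.
  by case: i / e b => b; rewrite -sm_Br -arrow_mapE memv_img ?memvf.
- by apply/arrows_intoS => i b x xW; rewrite mem_arrows_into // (subvP (addvSl _ _)).
- apply/subvP => _ /memv_imgP[b _ ->]; rewrite arrow_mapE mem_arrows_into //.
  by apply: subvP (addvSr _ _) _ _; rewrite -{1}ey memv_Dline.
Qed.

(** The dimension of the sum over j of B_jl (x) U_j: for a projective module, the
    products b y are as independent as they can be. Adding a line D_j y to W adds the
    products b y with b in B_jl, and a splitting of a suitable cocycle shows that
    these form a copy of B_jl independent of the products with W. *)
Lemma dim_arrows_into P (U : {vspace P}) l : projective P -> Dstable U ->
  \dim (arrows_into U l) = (\sum_j \dim {:B j l} * dimv U j)%N.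
Proof.
move=> hP; move: U; apply: Dstable_ind => [|W j y hW h ey yW].
  rewrite big1 => [|j _]; last by rewrite dimv0E muln0.
  apply/eqP; rewrite dimv_eq0 -subv0; apply/arrows_intoS => j b x.
  by rewrite memv0 => /eqP->; rewrite linear0 mem0v.
have [a [ha /subvP aW ay]] := Dfunctional hW ey yW.
(* Solving the cocycle (b, x) |-> b a(x) with values in B_jl gives f with
   f(b y) = b, while f kills the products of arrows into l with W. *)
pose N : smod := vertex_smod (@bim_l1 k _ _ (B j l)) (@bim_lM k _ _ (B j l)).
pose F (b : B j l) (x : P) : N := bim_r (B j l) (a x) b.
have [||||psi [hpsi psiE psi0]] := @arrow_cocycle P N j l F.
- by move=> x c u v; rewrite /F linearP.
- by move=> b c u v; rewrite /F !linearP add_lfunE scale_lfunE.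
- by move=> c b x; rewrite vertex_Dl /F bim_lr.
- by move=> c b x; rewrite /F ha simple_Dii -bim_rM mulrC.
have [f fD fB] := projective_cocycle hP hpsi.
have f0 i (b : B i l) w : w \in W -> f (sm_B P i l b w) = 0.
  move=> /aW; rewrite memv_ker fB vertex_B add0r => /eqP aw.
  have [e|ne] := eqVneq j i; last by rewrite psi0 // xpair_eqE negb_and ne.
  by case: i / e b => b; rewrite psiE /F aw linear0 zero_lfunE.
have fy b : f (sm_B P j l b y) = b.
  by rewrite fB vertex_B add0r psiE /F ay bim_r1.
rewrite arrows_into_add_Dline // dimv_disjoint_sum; last first.
  apply/eqP; rewrite -subv0; apply/subvP => x; rewrite memv_cap memv0 => /andP[xW].
  move=> /memv_imgP[b _]; rewrite arrow_mapE => xE; rewrite xE.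
  suff -> : b = 0 by rewrite linear0 zero_lfunE.
  rewrite -(fy b) -xE; apply/eqP; rewrite -memv_ker; apply: subvP xW.
  by apply/arrows_intoS => i c w wW; rewrite memv_ker f0.
rewrite h limg_dim_eq; last first.
  apply/eqP; rewrite capfv -subv0; apply/subvP => b; rewrite memv_ker arrow_mapE memv0 => /eqP e.
  by rewrite -(fy b) e linear0.
rewrite [RHS](eq_bigr (fun i => \dim {:B i l} * dimv W i + \dim {:B i l} * (i == j))%N); last first.
  by move=> i _; rewrite dimv_add_Dline // mulnDr.
rewrite big_split /=; congr addn; rewrite (bigD1 j) //= eqxx muln1 big1 ?addn0 //.
by move=> i /negPf ->; rewrite muln0.
Qed.

(** By [radmE], this is the radical when the quiver is acyclic. *)
Definition arrow_span M : {vspace M} := (\sum_l arrows_into fullv l)%VS.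

Lemma arrow_spanS M (W : {vspace M}) :
  (forall j l (b : B j l) x, sm_B M j l b x \in W) <-> (arrow_span M <= W)%VS.
Proof.
split=> [h|h j l b x].
  by apply/subv_sumP => l _; apply/arrows_intoS => j b x _; apply: h.
apply: subvP h _ _; rewrite /arrow_span (bigD1 l) //=.
by apply: subvP (addvSl _ _) _ _; rewrite mem_arrows_into ?memvf.
Qed.

Lemma mem_arrow_span M j l (b : B j l) (x : M) : sm_B M j l b x \in arrow_span M.
Proof. exact: (arrow_spanS (arrow_span M)).2. Qed.

Lemma Dstable_into M (U : {vspace M}) l : Dstable (arrows_into U l).
Proof.
move=> i a x; move: x; suff /subvP h : (arrows_into U l <= sm_D M i a @^-1: arrows_into U l)%VS.
  by move=> x /h; rewrite -memv_preim.
apply/arrows_intoS => j b y yU; rewrite -memv_preim.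
have [e|ne] := eqVneq i l; last by rewrite DB_orth ?mem0v.
by case: l / e b => b; rewrite -sm_Bl mem_arrows_into.
Qed.

Lemma submod_arrow_span M : is_submod (arrow_span M).
Proof.
apply/submodP; split; last by move=> i j b x _; apply: mem_arrow_span.
rewrite /arrow_span; apply: big_ind => [|U W hU hW|l _].
- exact: Dstable0.
- exact: Dstable_add.
- exact: Dstable_into.
Qed.

Lemma vertex_part_arrow_span M l : vertex_part (arrow_span M) l = arrows_into fullv l.
Proof.
have [hD _] := (submodP (arrow_span M)).1 (submod_arrow_span M).
apply/vspaceP => x; rewrite vertex_partP //; apply/andP/idP => [[/memv_sumP[xs h ->] /eqP <-]|xl].
  rewrite linear_sum memv_suml //= => i _; have [e|ne] := eqVneq l i.
    by case: i / e; apply: Dstable_into; apply: h.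
  suff /subvP/(_ (xs i) (h i isT)): (arrows_into fullv i <= lker (sm_D M l 1%R))%VS.
    by rewrite memv_ker => /eqP->; apply: mem0v.
  by apply/arrows_intoS => j b y _; rewrite memv_ker DB_orth.
split; first by rewrite /arrow_span (bigD1 l) //=; apply: subvP (addvSl _ _) _ _.
suff /subvP/(_ x xl): (arrows_into fullv l <= lker (sm_D M l 1%R - \1%VF)%R)%VS.
  by rewrite memv_ker add_lfunE opp_lfunE id_lfunE subr_eq0.
by apply/arrows_intoS => j b y _; rewrite memv_ker add_lfunE opp_lfunE id_lfunE D1B subrr.
Qed.

Lemma Dstable_submod M (U : {vspace M}) : is_submod U -> Dstable U.
Proof. by case/submodP. Qed.

Lemma submod_over_arrow_span M (U : {vspace M}) :
  Dstable U -> (arrow_span M <= U)%VS -> is_submod U.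
Proof.
by move=> hD /arrow_spanS hB; apply/submodP; split=> // i j b x _; apply: hB.
Qed.

Lemma Dhom_simple M l (a : 'Hom(M, simple_smod S l)) :
  Dhom a -> (arrow_span M <= lker a)%VS -> is_hom a.
Proof.
move=> ha hB; split=> // i j b x; rewrite /= !zero_lfunE.
by apply/eqP; rewrite -memv_ker; apply: subvP hB _ (mem_arrow_span _ _).
Qed.

Lemma hom_simple_span M l (a : 'Hom(M, simple_smod S l)) :
  is_hom a -> (arrow_span M <= lker a)%VS.
Proof.
by move=> [_ h]; apply/arrow_spanS => i j b x; rewrite memv_ker h /= !zero_lfunE.
Qed.

Lemma memv_radm M (x : M) :
  x \in radm M <-> forall W, maximal_submod W -> x \in W.
Proof.
rewrite /radm memv_bigcap; split=> [/allP h W hW|h].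
  by apply: h; rewrite in_fset_set ?inE //; apply: vspace_finite.
by apply/allP => W; rewrite in_fset_set ?inE => [/h//|]; apply: vspace_finite.
Qed.

Lemma maximal_ker M l (a : 'Hom(M, simple_smod S l)) y :
  is_hom a -> a y = 1 -> maximal_submod (lker a).
Proof.
move=> ha ay; split.
- apply: submod_over_arrow_span; last exact: hom_simple_span.
  exact: Dstable_ker (is_hom_Dhom ha).
- by move=> e; have := memvf y; rewrite -e memv_ker ay oner_eq0.
move=> W /Dstable_submod hW kW.
have [h|] := boolP (W <= lker a)%VS.
  by left; apply/eqP; rewrite eqEsubv h.
case/subvPn => z zW; rewrite memv_ker => az; right.
apply/eqP; rewrite eqEsubv subvf; apply/subvP => x _.
pose d : D l := a x * (a z)^-1.
rewrite -[x](subrK (sm_D M l d z)) memvD ?hW //; apply: subvP kW _ _.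
by rewrite memv_ker linearB /= ha.1 simple_Dii /d mulfVK ?subrr.
Qed.

(** A vector outside the span is detected by a functional that vanishes on the span;
    such a functional is a homomorphism to a simple module, and its kernel is maximal. *)
Lemma radm_sub_span M : (radm M <= arrow_span M)%VS.
Proof.
apply/subvP => x /memv_radm hx; apply: memv_vertex_parts => i.
apply: contraT => nx; have hD := Dstable_submod (submod_arrow_span M).
have [a [ha aW ay]] := Dfunctional hD (D1D (1 : D i) x) nx.
have hha := Dhom_simple ha aW.
have := hx _ (maximal_ker hha ay); rewrite memv_ker => /eqP ax0.
by have := ha i 1 x; rewrite ay ax0 linear0 => /eqP; rewrite oner_eq0.
Qed.

Lemma maximal_over M (W : {vspace M}) : is_submod W -> W <> fullv ->
  exists W', maximal_submod W' /\ (W <= W')%VS.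
Proof.
move=> hW nW; have [W' [[h1 h2] h3 h4]] :=
  max_vspace (A := fun U : {vspace M} => is_submod U /\ U <> fullv) (conj hW nW).
exists W'; split=> //; split=> // U hU sU.
by have [e|ne] := pselect (U = fullv); [right|left; apply: h4].
Qed.

Lemma simple_dimv l i : dimv (fullv : {vspace simple_smod S l}) i = (i == l).
Proof.
apply/eqP; rewrite -(eqn_pmul2r (dimD_gt0 S i)) -dim_vertex_part; last exact: Dstablef.
have [->|ne] := eqVneq i l.
  rewrite mul1n; apply/eqP; congr (\dim _).
  apply/vspaceP => x; rewrite vertex_partP; last exact: Dstablef.
  by rewrite simple_Dii mul1r eqxx memvf.
suff -> : vertex_part (fullv : {vspace simple_smod S l}) i = 0%VS by rewrite dimv0.
apply/eqP; rewrite -subv0; apply/subvP => x; rewrite vertex_partP; last exact: Dstablef.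
by move=> /andP[_]; rewrite simple_Dij // => /eqP<-; rewrite mem0v.
Qed.

Section Acyclic.
Hypothesis hQ : acyclic Q.

Local Notation arrow := (fun x y => 0 < vq_arr Q x y)%N.

(** Strictly decreasing along arrows, which turns acyclicity into induction on a
    number. *)
Definition reach (i : I) : nat := #|connect arrow i|.

Lemma arrow_reach i j : (0 < vq_arr Q i j)%N -> (reach j < reach i)%N.
Proof.
move=> ij; apply: proper_card; apply/properP; split.
  by apply/fintype.subsetP => x; rewrite !inE; apply: connect_trans; apply: connect1.
exists i; rewrite inE ?connect0 //; apply/negP => /connectP[p hp e].
have := hQ (i := i) (p := j :: p); rewrite /= ij hp => /(_ isT (esym e)); discriminate.
Qed.

Lemma noarrow_B i j (b : B i j) : (vq_arr Q i j = 0)%N -> b = 0.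
Proof.
move=> h; have := sp_dimB S i j; rewrite h mul0n => /eqP; rewrite dimv_eq0 => /eqP e.
by apply/eqP; rewrite -memv0 -e memvf.
Qed.

(** Among the vertices where W is not everything, take one of largest reach: all
    arrows into it start at vertices where W is everything. *)
Lemma source_vertex M (W : {vspace M}) : is_submod W -> W <> fullv ->
  exists i y, [/\ sm_D M i 1 y = y, y \notin W & (arrows_into fullv i <= W)%VS].
Proof.
move=> /submodP[hD hB] nW.
pose A i := `[< exists y, sm_D M i 1 y = y /\ y \notin W >].
have [i0 Ai0] : exists i, A i.
  apply: contra_notP nW => no; apply/eqP; rewrite eqEsubv subvf; apply/subvP => x _.
  apply: memv_vertex_parts => i; apply: contra_notT no => nx.
  by exists i; apply/asboolP; exists (sm_D M i 1 x); rewrite D1D.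
case: (arg_maxnP reach Ai0) => i /asboolP[y [ey yW]] mx; exists i, y; split=> //.
apply/arrows_intoS => j b x _; have [h|h] := posnP (vq_arr Q j i).
  by rewrite (noarrow_B b h) linear0 zero_lfunE mem0v.
rewrite -BD1; apply: hB; apply: contraT => nx.
have /mx : A j by apply/asboolP; exists (sm_D M j 1 x); rewrite D1D.
by rewrite /= leqNgt arrow_reach.
Qed.

(** At the vertex given by [source_vertex] the span contributes nothing new to W. *)
Lemma nakayama M (W : {vspace M}) :
  is_submod W -> (W + arrow_span M)%VS = fullv -> W = fullv.
Proof.
move=> hW full; apply: contrapT => nW.
have [i [y [ey yW sW]]] := source_vertex hW nW.
case/negP: yW; have : y \in (W + arrow_span M)%VS by rewrite full memvf.
case/memv_addP => w wW [z zs yE]; rewrite -ey yE linearD memvD //.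
  exact: (Dstable_submod hW).
apply: subvP sW _ _; rewrite -vertex_part_arrow_span; exact: memv_img.
Qed.

(** A maximal submodule that did not contain the span would, together with it, be
    everything, against [nakayama]. *)
Lemma radmE M : radm M = arrow_span M.
Proof.
apply/eqP; rewrite eqEsubv radm_sub_span; apply/subvP => x xs.
apply/memv_radm => W [hW nW mx].
have hWs : is_submod (W + arrow_span M)%VS.
  apply: submod_over_arrow_span (addvSr _ _); apply: Dstable_add; apply: Dstable_submod => //.
  exact: submod_arrow_span.
have [e|/(nakayama hW)//] := mx _ hWs (addvSl _ _).
by rewrite -e; apply: subvP (addvSr _ _) _ _.
Qed.

Lemma dimv_radm P l : projective P ->
  (dimv (radm P) l * \dim {:D l} = \sum_j \dim {:B j l} * dimv (fullv : {vspace P}) j)%N.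
Proof.
move=> hP; rewrite radmE -dim_vertex_part; last exact: Dstable_submod (submod_arrow_span P).
rewrite vertex_part_arrow_span dim_arrows_into //; exact: Dstablef.
Qed.

End Acyclic.

End Radical.

(** * Extensions between simple modules *)

Section Extensions.
Variables (k : finFieldType) (I : finType) (Q : vquiver I) (S : species k Q).
Local Notation D := (sp_D S).
Local Notation B := (sp_B S).
Local Notation smod := (smod S).
Implicit Types L M N P : smod.

Lemma is_hom_comp L M N (f : 'Hom(M, N)) (g : 'Hom(L, M)) :
  is_hom f -> is_hom g -> is_hom (f \o g)%VF.
Proof.
by move=> [fD fB] [gD gB]; split=> *; rewrite !comp_lfunE ?gD ?gB ?fD ?fB.
Qed.

Lemma submod_img M N (f : 'Hom(M, N)) (U : {vspace M}) :
  is_hom f -> is_submod U -> is_submod (f @: U)%VS.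
Proof.
move=> [fD fB] /submodP[hD hB]; apply/submodP; split; first exact: Dstable_img.
by move=> i j b _ /memv_imgP[x xU ->]; rewrite -fB memv_img ?hB.
Qed.

Lemma submod_ker M N (f : 'Hom(M, N)) : is_hom f -> is_submod (lker f).
Proof.
move=> [fD fB]; apply/submodP; split; first exact: Dstable_ker.
by move=> i j b x; rewrite !memv_ker fB => /eqP->; rewrite linear0.
Qed.

Lemma submod_add M (U W : {vspace M}) : is_submod U -> is_submod W -> is_submod (U + W)%VS.
Proof.
move=> /submodP[hD hB] /submodP[hD' hB']; apply/submodP; split; first exact: Dstable_add.
move=> i j b _ /memv_addP[x xU [y yW ->]].
by rewrite linearD memv_add ?hB ?hB'.
Qed.

Lemma submod0 M : is_submod (0%VS : {vspace M}).
Proof.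
apply/submodP; split; first exact: Dstable0.
by move=> i j b x; rewrite !memv0 => /eqP->; rewrite linear0.
Qed.

Lemma submodf M : is_submod (fullv : {vspace M}).
Proof. by split=> *; apply: subvf. Qed.

Lemma submod_equalizer M N (f g : 'Hom(M, N)) : is_hom f -> is_hom g -> is_submod (lker (f - g)).
Proof.
move=> [fD fB] [gD gB]; apply: submod_ker; split=> *.
  by rewrite !add_lfunE !opp_lfunE fD gD linearB.
by rewrite !add_lfunE !opp_lfunE fB gB linearB.
Qed.

(** A D_l-vector space has the dimension of its dual. Along a chain of D-stable
    subspaces U of N, each new line D_l y takes away from the homomorphisms vanishing
    on U a copy of D_l, namely the possible values at y. *)
Lemma dim_hom_simple N l :
  (forall i j (b : B i j) (x : N), sm_B N i j b x = 0) ->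
  (forall i (a : D i) (x : N), i != l -> sm_D N i a x = 0) ->
  \dim (homsp N (simple_smod S l)) = \dim {:N}.
Proof.
move=> NB ND; pose H := homsp N (simple_smod S l).
(* Ann U consists of the homomorphisms that vanish on U: the composite with the
   projection onto U is zero. *)
pose Ann (U : {vspace N}) :=
  (H :&: lker (linfun (@precomp _ _ _ S N N (simple_smod S l) (projv U))))%VS.
have HP f : f \in H <-> Dhom f.
  split=> [/homspP[]//|hf]; apply/homspP; split=> // i j b x.
  by rewrite NB linear0 /= !zero_lfunE.
have AnnP U f : f \in Ann U <-> Dhom f /\ (forall x, x \in U -> f x = 0).
  rewrite memv_cap memv_ker lfunE /=; split.
    move=> /andP[/HP hf /eqP e]; split=> // x xU.
    by have := congr1 (fun g : 'Hom(N, simple_smod S l) => g x) e; rewrite zero_lfunE comp_lfunE projv_id.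
  move=> [/HP -> h]; apply/eqP/lfunP => x.
  by rewrite zero_lfunE comp_lfunE h ?memv_proj.
suff dimA U : Dstable U -> (\dim (Ann U) + \dim U)%N = \dim H.
  rewrite -/H -(dimA _ (@Dstablef _ _ _ _ N)); suff -> : Ann fullv = 0%VS by rewrite dimv0.
  apply/eqP; rewrite -subv0; apply/subvP => f /AnnP[_ h]; rewrite memv0.
  by apply/eqP/lfunP => x; rewrite h ?memvf // zero_lfunE.
move: U; apply: Dstable_ind => [|W j y hW h ey yW].
  rewrite dimv0 addn0; congr (\dim _); apply/vspaceP => f; apply/idP/idP => [/AnnP[/HP]//|/HP hf].
  by apply/AnnP; split=> // x; rewrite memv0 => /eqP->; rewrite linear0.
have y0 : y != 0 by apply: contraNneq yW => ->; rewrite mem0v.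
have jl : j = l by apply/eqP; apply: contraNT y0 => ne; rewrite -ey ND.
case: l / jl in H Ann HP AnnP ND h *.
have cap0 : (W :&: Dline j y = 0)%VS by rewrite capvC; apply: Dline_cap.
rewrite dimv_disjoint_sum // dim_Dline // -h addnCA [RHS]addnC; congr addn.
pose ev : 'Hom('Hom(N, simple_smod S j), D j) := eval_at \1%VF y.
have evE f : ev f = f y by rewrite /ev eval_atE id_lfunE.
rewrite -(limg_ker_dim ev (Ann W)); congr addn; last first.
  apply/esym; congr (\dim _); apply/eqP; rewrite eqEsubv subvf; apply/subvP => d _.
  have [a [ha /subvP aW ay]] := Dfunctional hW ey yW.
  have gl : linear (fun x => (a x : D j) * d).
    by move=> c u v; rewrite [a _](linearP a c u v) mulrDl scalerAl.
  have [g gE] := lin_lfun (W := simple_smod S j) gl.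
  apply/memv_imgP; exists g; last by rewrite evE gE ay mul1r.
  apply/AnnP; split=> [i c x|x /aW]; last by rewrite memv_ker gE => /eqP->; rewrite mul0r.
  rewrite !gE ha; have [/esym e|ne] := eqVneq i j; last by rewrite !simple_Dij // mul0r.
  by case: i / e c => c; rewrite !simple_Dii mulrA.
congr (\dim _); apply/vspaceP => f; rewrite [RHS]memv_cap memv_ker evE; apply/idP/idP.
  move=> /AnnP[hf fz]; apply/andP; split.
    by apply/AnnP; split=> // x xW; apply: fz; apply: subvP (addvSl _ _) _ _.
  by rewrite fz // (subvP (addvSr _ _)) // -{1}ey memv_Dline.
move=> /andP[/AnnP[hf fz] /eqP fy]; apply/AnnP; split=> // _ /memv_addP[w wW [_ /DlineP[d ->] ->]].
by rewrite linearD /= fz // hf fy linear0 addr0.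
Qed.

Lemma dim_end_simple l : \dim (homsp (simple_smod S l) (simple_smod S l)) = \dim {:D l}.
Proof.
rewrite dim_hom_simple //; first by move=> i j b x; rewrite /= !zero_lfunE.
by move=> i a x ne; rewrite simple_Dij.
Qed.

(** Lift the generator 1 of S_j to p in P. A homomorphism f from the kernel O to S_l
    is determined modulo those that extend to P by the values f(b p) for b in B_jl,
    and every D_l-linear functional on B_jl occurs in this way. *)
Lemma ext1_via_simple j l (r : presentation (simple_smod S j)) :
  ext1_via (simple_smod S l) r = \dim {:B j l}.
Proof.
case: r => O P io pr hP [[iD iB] [pD pB] ki im sp]; rewrite /ext1_via /=.
set SJ := simple_smod S j; set SL := simple_smod S l.
have iK : cancel io (io^-1)%VF by apply: lker0_lfunK; apply/eqP.
have iVK x : pr x = 0 -> io ((io^-1)%VF x) = x.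
  by move=> px; apply: limg_lfunVK; rewrite im memv_ker px.
have pi z : pr (io z) = 0 by apply/eqP; rewrite -memv_ker -im memv_img ?memvf.
have iVD i (a : D i) x : pr x = 0 -> (io^-1)%VF (sm_D P i a x) = sm_D O i a ((io^-1)%VF x).
  by move=> px; apply: (can_inj iK); rewrite iD !iVK // pD px linear0.
have iVB i' j' (b : B i' j') x : pr x = 0 -> (io^-1)%VF (sm_B P i' j' b x) = sm_B O i' j' b ((io^-1)%VF x).
  by move=> px; apply: (can_inj iK); rewrite iB !iVK // pB px linear0.
have prB i' j' (b : B i' j') x : pr (sm_B P i' j' b x) = 0 by rewrite pB /= !zero_lfunE.
(* Replacing a preimage of 1 by its part at j keeps it a preimage of 1. *)
have [p [ep pp]] : exists p, sm_D P j 1 p = p /\ pr p = 1.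
  have /memv_imgP[p _ e] : (1 : D j) \in limg pr by rewrite sp memvf.
  by exists (sm_D P j 1 p); rewrite D1D pD -e simple_Dii mulr1.
pose N : smod := vertex_smod (@bim_l1 k _ _ (B j l)) (@bim_lM k _ _ (B j l)).
(* c sends b to b p, seen in O; T restricts a homomorphism along c. *)
pose c : 'Hom(N, O) := (io^-1 \o arrow_map j l p)%VF.
have cE b : c b = (io^-1)%VF (sm_B P j l b p) by rewrite comp_lfunE arrow_mapE.
have Tl : linear (fun f : 'Hom(O, SL) => (f \o c)%VF).
  by move=> a u v; rewrite comp_lfunDl comp_lfunZl.
have [T TE] := lin_lfun Tl.
pose R : 'Hom('Hom(P, SL), 'Hom(O, SL)) := linfun (@precomp _ _ _ S O P SL io).
have RE f : R f = (f \o io)%VF by rewrite lfunE.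
have kerE : (R @: homsp P SL = homsp O SL :&: lker T)%VS.
  apply/vspaceP => f; rewrite memv_cap memv_ker TE; apply/memv_imgP/andP.
    move=> [F /homspP[FD FB] ->]; rewrite RE; split.
      by apply/homspP; split=> *; rewrite !comp_lfunE ?iD ?iB ?FD ?FB.
    apply/eqP/lfunP => b; rewrite !comp_lfunE arrow_mapE iVK ?prB // FB /= !zero_lfunE //.
  move=> [/homspP[fD fB] /eqP fc].
  have fc0 b : f ((io^-1)%VF (sm_B P j l b p)) = 0.
    by rewrite -cE -comp_lfunE fc zero_lfunE.
  (* s is the D-linear projection of P onto the image of O along D_j p, and f o s
     extends f. It commutes with the arrows since f vanishes on the vectors b p. *)
  pose s : 'Hom(P, P) := \1%VF - (Dline_map j p \o pr)%VF.
  have sE x : s x = x - sm_D P j (pr x) p.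
    by rewrite add_lfunE opp_lfunE id_lfunE comp_lfunE Dline_mapE.
  have ps x : pr (s x) = 0 by rewrite sE linearB /= pD pp simple_Dii mulr1 subrr.
  exists (f \o (io^-1 \o s))%VF; last first.
    by rewrite RE; apply/lfunP => x; rewrite !comp_lfunE sE pi linear0 zero_lfunE subr0 iK.
  apply/homspP; split=> [i a x|i' j' b x]; rewrite !comp_lfunE.
    rewrite -fD -iVD //; congr (f ((io^-1)%VF _)); rewrite !sE linearB /=; congr (_ - _).
    have [e|ne] := eqVneq j i.
      by case: i / e a => a; rewrite pD simple_Dii sm_DM.
    by rewrite pD simple_Dij 1?eq_sym // linear0 zero_lfunE sm_D_orth // eq_sym.
  have -> : s (sm_B P i' j' b x) = sm_B P i' j' b x by rewrite sE prB linear0 zero_lfunE subr0.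
  rewrite [in RHS]/= !zero_lfunE -[x](subrK (sm_D P j (pr x) p)) -sE.
  rewrite [sm_B _ _ _ _ _]linearD [(io^-1)%VF _]linearD /= iVB // linearD /= fB /= !zero_lfunE add0r.
  have [e|ne] := eqVneq j i'; last by rewrite BD_orth // !linear0.
  case: i' / e b => b; rewrite -sm_Br; set b' := bim_r _ _ _.
  have [e|ne] := eqVneq l j'; first by case: j' / e b b' => b b'; apply: fc0.
  by rewrite -D1B iVD ?prB // fD simple_Dij // eq_sym.
have imE : (T @: homsp O SL = homsp N SL)%VS.
  apply/vspaceP => f; apply/memv_imgP/idP.
    move=> [F /homspP[FD FB] ->]; rewrite TE; apply/homspP; split=> [i a x|i' j' b x].
      rewrite !comp_lfunE -FD !arrow_mapE; have [e|ne] := eqVneq l i.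
        by case: i / e a => a; rewrite vertex_Dl -iVD ?prB // -sm_Bl.
      by rewrite vertex_Dn // linear0 zero_lfunE linear0 -iVD ?prB // DB_orth ?linear0 // eq_sym.
    by rewrite !comp_lfunE vertex_B !linear0 /= !zero_lfunE.
  move=> /homspP[fD fB].
  (* The functional f on B_jl defines the cocycle (b, x) |-> f(b pr(x)) on P. It
     vanishes on O, where its solution g is therefore a homomorphism. *)
  pose F (b : B j l) (x : P) : SL := f (bim_r (B j l) (pr x) b).
  have [x c0 u v|b c0 u v|a b x|a b x|psi [hpsi psiE psi0]] := @arrow_cocycle _ _ _ _ P SL j l F.
  - by rewrite /F !linearP.
  - by rewrite /F !linearP add_lfunE scale_lfunE linearP.
  - by rewrite /F -bim_lr; have := fD l a (bim_r (B j l) (pr x) b); rewrite vertex_Dl.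
  - by rewrite /F pD simple_Dii -bim_rM mulrC.
  have [g gD gB] := projective_cocycle hP hpsi.
  exists (g \o io)%VF.
    apply/homspP; split=> [i a x|i' j' b x]; rewrite !comp_lfunE ?iD ?gD //.
    rewrite iB gB; have [e|ne] := eqVneq (j, l) (i', j'); last by rewrite psi0 // addr0.
    case: e b => <- <- b; rewrite psiE; suff -> : F b (io x) = 0 by rewrite addr0.
    by rewrite /F (pi x : _ = (0 : D j)) linear0 zero_lfunE linear0.
  rewrite TE; apply/lfunP => b; rewrite !comp_lfunE arrow_mapE iVK ?prB // gB /= !zero_lfunE add0r.
  by rewrite psiE /F pp bim_r1.
rewrite -(limg_ker_dim T (homsp O SL)) -/R kerE addKn imE dim_hom_simple //.
- by move=> *; rewrite vertex_B.
- by move=> i a x ne; rewrite vertex_Dn // eq_sym.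
Qed.

Section Acyclic.
Hypothesis hQ : acyclic Q.

Definition generates M (x : M) : Prop :=
  forall U : {vspace M}, is_submod U -> x \in U -> U = fullv.

Lemma dim_add_leq (V : vectType k) (U W : {vspace V}) :
  (\dim (U + W) <= \dim U + \dim W)%N.
Proof. by rewrite -dimv_sum_cap leq_addr. Qed.

(** The submodule generated by y is D_i y plus the submodules generated by the
    vectors b y, which live at vertices of smaller reach. *)
Lemma submod_bound i : exists C : nat, forall M (y : M), sm_D M i 1 y = y ->
  exists U : {vspace M}, [/\ is_submod U, y \in U & (\dim U <= C)%N].
Proof.
move: {2}(reach Q i) (erefl (reach Q i)) => m; elim/ltn_ind: m i => m IH i hm.
have /choice[C hC] : forall l, exists C : nat, forall M (y : M) (b : B i l),
    exists U : {vspace M}, [/\ is_submod U, sm_B M i l b y \in U & (\dim U <= C)%N].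
  move=> l; have [h|h] := posnP (vq_arr Q i l).
    exists 0%N => M y b; exists 0%VS; split; rewrite ?dimv0 //; first exact: submod0.
    by rewrite (noarrow_B b h) linear0 zero_lfunE mem0v.
  have [|C hC] := IH _ _ l erefl; first by rewrite -hm arrow_reach.
  by exists C => M y b; apply: hC; rewrite D1B.
exists (\dim {:D i} + \sum_l \sum_(b <- vbasis {:B i l}) C l)%N => M y ey.
have /choice[U hU] : forall lb : {l & B i l}, exists U : {vspace M},
    [/\ is_submod U, sm_B M i (tag lb) (tagged lb) y \in U & (\dim U <= C (tag lb))%N].
  by move=> [l b]; apply: hC.
(* The submodules at the basis vectors b of B_il suffice, by linearity in b. *)
pose W l (b : B i l) := U (Tagged (fun l => B i l) b).
pose V := (\sum_l \sum_(b <- vbasis {:B i l}) W l b)%VS.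
have hV : is_submod V.
  apply: big_ind => [|? ?|l _]; [exact: submod0|exact: submod_add|].
  apply: big_ind => [|? ?|b _]; [exact: submod0|exact: submod_add|].
  by case: (hU (Tagged (fun l => B i l) b)).
have bV l (b : B i l) : sm_B M i l b y \in V.
  rewrite (coord_vbasis (memvf b)) linear_sum sum_lfunE memv_suml // => s _.
  have bs : (vbasis {:B i l})`_s \in vbasis {:B i l} by rewrite mem_nth ?size_tuple.
  rewrite linearZ scale_lfunE memvZ // /V (bigD1 l) //= (big_rem _ bs) /=.
  apply: subvP (addvSl _ _) _ _; apply: subvP (addvSl _ _) _ _.
  by case: (hU (Tagged (fun l => B i l) (vbasis {:B i l})`_s)).
exists (Dline i y + V)%VS; split.
- apply/submodP; split.
    by apply: Dstable_add; [exact: Dstable_Dline|exact: Dstable_submod].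
  move=> i' j b _ /memv_addP[_ /DlineP[d ->] [v vV ->]].
  apply: subvP (addvSr _ _) _ _; rewrite linearD memvD //=; last first.
    by case/submodP: hV => _; apply.
  have [e|ne] := eqVneq i i'; last by rewrite BD_orth ?mem0v.
  by case: i' / e b => b; rewrite -sm_Br.
- by apply: subvP (addvSl _ _) _ _; rewrite -{1}ey memv_Dline.
apply: leq_trans (dim_add_leq _ _) _; apply: leq_add.
  by rewrite -(limg_ker_dim (Dline_map i y) fullv) leq_addl.
apply: (big_ind2 (fun (U : {vspace M}) n => \dim U <= n)%N); first by rewrite dimv0.
  by move=> U1 n1 U2 n2 h1 h2; apply: leq_trans (dim_add_leq _ _) _; apply: leq_add.
move=> l _; apply: (big_ind2 (fun (U : {vspace M}) n => \dim U <= n)%N); first by rewrite dimv0.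
  by move=> U1 n1 U2 n2 h1 h2; apply: leq_trans (dim_add_leq _ _) _; apply: leq_add.
by move=> b _; case: (hU (Tagged (fun l => B i l) b)).
Qed.

Lemma minimal_submod M (x : M) : exists U : {vspace M},
  [/\ is_submod U, x \in U & forall W, is_submod W -> x \in W -> (W <= U)%VS -> W = U].
Proof.
pose A n := `[< exists U : {vspace M}, [/\ is_submod U, x \in U & \dim U = n] >].
have exA : exists n, A n.
  exists (\dim {:M}); apply/asboolP; exists fullv; split; rewrite ?memvf //.
  exact: submodf.
case: (ex_minnP exA) => n /asboolP[U [hU xU dU]] mn; exists U; split=> // W hW xW WU.
apply/eqP; rewrite eqEdim WU dU mn //; by apply/asboolP; exists W.
Qed.

Lemma generated_submod M (x : M) : exists N (f : 'Hom(N, M)) (z : N),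
  [/\ is_hom f, lker f = 0%VS, f z = x & generates z].
Proof.
have [U [hU xU mn]] := minimal_submod x.
exists (submod_smod hU), (sub_incl hU), (vsproj U x); split.
- exact: sub_incl_hom.
- exact: sub_incl_ker.
- by rewrite sub_inclE vsprojK.
move=> W hW xW; have e : (sub_incl hU @: W)%VS = U.
  apply: mn; first by apply: submod_img (sub_incl_hom hU) hW.
    by apply/memv_imgP; exists (vsproj U x); rewrite // sub_inclE vsprojK.
  by apply: subv_trans (limgS _ (subvf _)) _; rewrite sub_incl_img.
have d : \dim (sub_incl hU @: W) = \dim W by rewrite limg_dim_eq // sub_incl_ker capv0.
by apply/eqP; rewrite eqEdim subvf sub_dim -d e /=.
Qed.

(** The projective module attached to a vertex, without paths: among the modules
    generated by one vector at i, whose dimensions are bounded, one of largest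
    dimension maps to every other. *)
Lemma free_cyclic i : exists P (x : P), [/\ sm_D P i 1 x = x, generates x &
  forall M (y : M), sm_D M i 1 y = y -> exists2 h : 'Hom(P, M), is_hom h & h x = y].
Proof.
have [C hC] := submod_bound i.
pose A n := `[< exists P (x : P), [/\ sm_D P i 1 x = x, generates x & \dim {:P} = n] >].
have exA : exists n, A n.
  exists (\dim {:zero_smod S}); apply/asboolP; exists (zero_smod S), 0; split=> //.
    by rewrite linear0.
  move=> U _ _; apply/vspaceP => x; rewrite (rV0_eq x 0) memvf mem0v //.
have bdA n : A n -> (n <= C)%N.
  move=> /asboolP[P [x [ex gx <-]]]; have [U [hU xU]] := hC _ _ ex.
  by rewrite (gx U).
case: (ex_maxnP exA bdA) => n /asboolP[P [x [ex gx dP]]] mx; exists P, x; split=> // M y ey.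
have hz : cocycle (fun i j => 0 : 'Hom(B i j, 'Hom(P, M))).
  by split=> *; rewrite !zero_lfunE ?linear0.
(* The submodule of P + M generated by (x, y) maps onto P because x generates P.
   By maximality of dim P the map is bijective: the submodule is the graph of a
   homomorphism from P to M. *)
pose E := ext_smod hz.
have [p1 p1E] := lin_lfun (V := E) (W := P) (f := fst) (fun _ _ _ => erefl).
have [p2 p2E] := lin_lfun (V := E) (W := M) (f := snd) (fun _ _ _ => erefl).
have p1h : is_hom p1 by split=> *; rewrite !p1E ?ext_DE ?ext_BE.
have p2h : is_hom p2.
  by split=> *; rewrite !p2E ?ext_DE ?ext_BE //= !zero_lfunE addr0.
have [N [f [z [hf kf fz gz]]]] := generated_submod ((x, y) : E).
have ez : sm_D N i 1 z = z.
  have fI : injective f by apply/lker0P; rewrite kf.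
  by apply: fI; rewrite hf.1 fz ext_DE /= ex ey.
pose q := (p1 \o f)%VF; have hq : is_hom q by apply: is_hom_comp.
have qz : q z = x by rewrite comp_lfunE fz p1E.
have sq : limg q = fullv.
  apply: gx; first by apply: submod_img (submodf N).
  by rewrite -qz memv_img ?memvf.
have kq : lker q == 0%VS.
  rewrite -dimv_eq0 -leqn0 -(leq_add2r (\dim {:P})) add0n -{1}sq -[lker q]capfv limg_ker_dim dP.
  by apply: mx; apply/asboolP; exists N, z.
have qK := lker0_lfunK kq; have qVK u : q ((q^-1)%VF u) = u.
  by apply: limg_lfunVK; rewrite sq memvf.
exists (p2 \o f \o q^-1)%VF; last by rewrite !comp_lfunE -qz qK fz p2E.
apply: is_hom_comp; first exact: is_hom_comp.
by split=> *; apply: (can_inj qK); rewrite ?hq.1 ?hq.2 !qVK.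
Qed.

Lemma presentation_of M P (p : 'Hom(P, M)) : projective P -> is_hom p -> limg p = fullv ->
  inhabited (presentation M).
Proof.
move=> hP hp sp; have hU := submod_ker hp.
constructor; apply: (@Presentation k I Q S M (submod_smod hU) P (sub_incl hU) p hP).
by split=> //; [exact: sub_incl_hom|exact: sub_incl_ker|exact: sub_incl_img].
Qed.

(** A free cyclic module is projective, because homomorphisms from it can be lifted on
    the generator. *)
Lemma simple_presentation i : inhabited (presentation (simple_smod S i)).
Proof.
have [P [x [ex gx fx]]] := free_cyclic i.
have e1 : sm_D (simple_smod S i) i 1 1 = (1 : simple_smod S i) by rewrite simple_Dii mulr1.
have [p hp px] := fx (simple_smod S i) 1 e1.
apply: (presentation_of (p := p)) => //.
  move=> M N g f hg sg hf; have /memv_imgP[m _ gm] : f x \in limg g by rewrite sg memvf.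
  have [h hh hx] := fx M (sm_D M i 1 m) (D1D _ _).
  exists h => //; apply/lfunP => u.
  have hgh := is_hom_comp hg hh.
  have /(gx _ (submod_equalizer hgh hf)) e : x \in lker ((g \o h)%VF - f).
    by rewrite memv_ker add_lfunE opp_lfunE comp_lfunE hx hg.1 -gm -hf.1 ex subrr.
  by have := memvf u; rewrite -e memv_ker add_lfunE opp_lfunE subr_eq0 => /eqP.
apply/eqP; rewrite eqEsubv subvf; apply/subvP => d _; apply/memv_imgP.
exists (sm_D P i d x); rewrite ?memvf // hp.1 px simple_Dii mulr1 //.
Qed.

Lemma ext1_simple j l : ext1 (simple_smod S j) (simple_smod S l) = \dim {:B j l}.
Proof.
have [r] := simple_presentation j; rewrite /ext1.
by case: xgetP => [d -> [r' ->]|/(_ _ (ex_intro _ r erefl))//]; apply: ext1_via_simple.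
Qed.

End Acyclic.

End Extensions.

(** * Splitting off indecomposable projectives *)

Section Projectives.
Variables (k : finFieldType) (I : finType) (Q : vquiver I) (S : species k Q).
Local Notation D := (sp_D S).
Local Notation B := (sp_B S).
Local Notation smod := (smod S).
Implicit Types L M N : smod.

Lemma vspace_dim0 (V : vectType k) (U W : {vspace V}) : \dim {:V} = 0%N -> U = W.
Proof.
move=> d; have Z (X : {vspace V}) : X = 0%VS.
  by apply/eqP; rewrite -dimv_eq0 -leqn0 -d dimvS ?subvf.
by rewrite (Z U) (Z W).
Qed.

Lemma dim_zero_smod : \dim {:zero_smod S} = 0%N.
Proof. exact: dim_rV0. Qed.

Lemma dimv_zero_smod (U : {vspace zero_smod S}) i : dimv U i = 0%N.
Proof. by rewrite (vspace_dim0 U 0%VS dim_zero_smod) dimv0E. Qed.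

Lemma ses_zero_id M : short_exact (0 : 'Hom(zero_smod S, M)) (\1%VF : 'Hom(M, M)).
Proof.
split; [exact: is_hom0|exact: is_hom1| | |].
- exact: vspace_dim0 dim_zero_smod.
- rewrite (vspace_dim0 fullv 0%VS dim_zero_smod) limg0; apply/esym/eqP/lker0P => x y.
  by rewrite !id_lfunE.
- by rewrite lim1g.
Qed.

Lemma ses_id_zero M : short_exact (\1%VF : 'Hom(M, M)) (0 : 'Hom(M, zero_smod S)).
Proof.
split; [exact: is_hom1|exact: is_hom0| | |].
- by apply/eqP/lker0P => x y; rewrite !id_lfunE.
- apply/vspaceP => x; rewrite lim1g memvf memv_ker zero_lfunE eqxx //.
- exact: vspace_dim0 dim_zero_smod.
Qed.

Lemma ses_zero L M N : \dim {:L} = 0%N -> \dim {:M} = 0%N -> \dim {:N} = 0%N ->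
  short_exact (0 : 'Hom(L, M)) (0 : 'Hom(M, N)).
Proof.
by move=> dL dM dN; split; rewrite ?is_hom0 //; try (exact: is_hom0); exact: vspace_dim0.
Qed.

(** The kernel of a split epimorphism is a direct summand. *)
Lemma split_kernel_projective (P P' : smod) (g : 'Hom(P, P')) (hg : is_hom g) : limg g = fullv ->
  projective P -> projective P' -> projective (submod_smod (submod_ker hg)).
Proof.
move=> sg hP hP'; set K := submod_smod _; set hU := submod_ker hg.
have [s hs gs] := hP' _ _ g \1%VF hg sg (is_hom1 P').
have gsx x : g (s x) = x by rewrite -comp_lfunE gs id_lfunE.
pose q : 'Hom(P, P) := \1%VF - (s \o g)%VF.
have qE x : q x = x - s (g x) by rewrite add_lfunE opp_lfunE id_lfunE comp_lfunE.
have hq : is_hom q.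
  by split=> *; rewrite !qE ?hg.1 ?hg.2 ?hs.1 ?hs.2 linearB.
have [|r hr re] := sub_factor hU hq.
  by apply/subvP => _ /memv_imgP[x _ ->]; rewrite memv_ker qE linearB /= gsx subrr.
have rK x : r (sub_incl hU x) = x.
  have incI : injective (sub_incl hU) by apply/lker0P; rewrite sub_incl_ker.
  apply: incI.
  have -> : sub_incl hU (r (sub_incl hU x)) = q (sub_incl hU x) by rewrite -re comp_lfunE.
  have : sub_incl hU x \in lker g by rewrite sub_inclE subvsP.
  by rewrite qE memv_ker => /eqP->; rewrite linear0 subr0.
move=> M N h f hh sh hf.
have [t ht te] := hP _ _ h (f \o r)%VF hh sh (is_hom_comp hf hr).
exists (t \o sub_incl hU)%VF; first exact: is_hom_comp ht (sub_incl_hom hU).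
apply/lfunP => x; have := congr1 (fun z : 'Hom(P, N) => z (sub_incl hU x)) te.
by rewrite !comp_lfunE rK.
Qed.

(** Lift the quotient map of P to the cover P' of the simple module. A proper image would
    lie in a maximal submodule of P', which contains the radical, that is, the kernel
    of P' -> S_l; but image and kernel together are all of P'. *)
Lemma projective_cover_surj (P P' : smod) l
    (t : 'Hom(P', simple_smod S l)) (a : 'Hom(P, simple_smod S l)) :
  projective P -> is_hom a -> limg a = fullv ->
  is_hom t -> limg t = fullv -> lker t = radm P' ->
  exists2 u : 'Hom(P, P'), is_hom u & limg u = fullv.
Proof.
move=> hP ha sa ht st kt; have [u hu ue] := hP _ _ t a ht st ha.
exists u => //; apply: contrapT => nu.
have [W [mW sW]] := maximal_over (submod_img hu (submodf P)) nu.
case: (mW) => hW nW _; apply: nW; apply/eqP; rewrite eqEsubv subvf; apply/subvP => x _.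
have /memv_imgP[z _ az] : t x \in limg a by rewrite sa memvf.
rewrite -[x](subrK (u z)) memvD //; last by apply: subvP sW _ _; rewrite memv_img ?memvf.
have : x - u z \in radm P' by rewrite -kt memv_ker linearB /= az -ue comp_lfunE subrr.
by move/memv_radm; apply.
Qed.

Section Acyclic.
Hypothesis hQ : acyclic Q.

(** Apply [source_vertex] to the zero submodule: no arrow acts nontrivially into the
    vertex found, so functionals there are homomorphisms. *)
Lemma simple_quotient M : (0 < \dim {:M})%N ->
  exists l (a : 'Hom(M, simple_smod S l)), is_hom a /\ limg a = fullv.
Proof.
move=> d; have [e|i [y [ey yW sW]]] := source_vertex hQ (submod0 M).
  by move: d; rewrite -e dimv0.
have yW' : y \notin arrow_span M.
  apply: contra yW => ys; apply: subvP sW _ _; rewrite -vertex_part_arrow_span -ey; exact: memv_img.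
have [a [ha aW ay]] := Dfunctional (Dstable_submod (submod_arrow_span M)) ey yW'.
exists i, a; split; first exact: Dhom_simple.
apply/eqP; rewrite eqEsubv subvf; apply/subvP => x _; apply/memv_imgP.
by exists (sm_D M i x y); rewrite ?memvf // ha ay simple_Dii mulr1.
Qed.

Variable Pi : I -> projmod S.
Hypothesis hPi : forall i, is_top (Pi i) (simple_smod S i).

Lemma split_off (P : projmod S) : (0 < \dim {:P})%N ->
  exists i (K : projmod S) (u : 'Hom(K, P)) (g : 'Hom(P, Pi i)),
    short_exact u g /\ (\dim {:K} < \dim {:P})%N.
Proof.
move=> d; have [i [a [ha sa]]] := simple_quotient d.
have [t [ht st kt]] := hPi i.
have [g hg sg] := projective_cover_surj (@pm_projP _ _ _ _ P) ha sa ht st kt.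
have hK := split_kernel_projective (hg := hg) sg (@pm_projP _ _ _ _ P) (@pm_projP _ _ _ _ (Pi i)).
exists i, (ProjMod hK), (sub_incl (submod_ker hg)), g; split.
  by split=> //; [exact: sub_incl_hom|exact: sub_incl_ker|exact: sub_incl_img].
rewrite sub_dim -(limg_ker_dim g fullv) capfv sg -addn1 leq_add2l.
have : (0 < \dim (limg t))%N by rewrite st dimD_gt0.
by move=> h; apply: leq_trans h _; rewrite -(limg_ker_dim t fullv) leq_addl.
Qed.

End Acyclic.
End Projectives.

(** * The Grothendieck group of the category of morphisms of projectives *)

Section GrothendieckGroup.
Variables (k : finFieldType) (I : finType) (Q : vquiver I) (S : species k Q).
Local Notation C2 := (C2 S).
Local Notation K0term := (K0term S).
Implicit Types (s t u : K0term) (X Y Z : C2).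

Lemma K0eq_catl s t t' : K0eq t t' -> K0eq (s ++ t) (s ++ t').
Proof. by move=> h; apply: K0eq_cat => //; apply: K0eq_refl. Qed.

Lemma K0eq_catr s t t' : K0eq t t' -> K0eq (t ++ s) (t' ++ s).
Proof. by move=> h; apply: K0eq_cat => //; apply: K0eq_refl. Qed.

Lemma K0eq_move s t u : K0eq (s ++ t ++ u) (t ++ s ++ u).
Proof. rewrite !catA; apply: K0eq_catr; exact: K0eq_comm. Qed.

Lemma K0eq_map_add (J : Type) (r : seq J) (a b : J -> int) (X : J -> C2) :
  K0eq ([seq (a j, X j) | j <- r] ++ [seq (b j, X j) | j <- r])
       [seq (a j + b j, X j) | j <- r].
Proof.
elim: r => [|j r IH] /=; first exact: K0eq_refl.
rewrite -cat1s -[(b j, X j) :: _]cat1s -[(_ + _, _) :: _]cat1s.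
apply: K0eq_trans (K0eq_catl _ (K0eq_move _ _ _)) _; rewrite catA.
apply: K0eq_cat IH; exact/K0eq_sym/K0eq_add.
Qed.

Lemma K0eq_map0 (J : Type) (r : seq J) (a : J -> int) (X : J -> C2) :
  (forall j, a j = 0) -> K0eq [seq (a j, X j) | j <- r] [::].
Proof.
move=> a0; elim: r => [|j r IH] /=; first exact: K0eq_refl.
by rewrite a0 -[_ :: _]cat1s -[[::]]/([::] ++ [::]); apply: K0eq_cat (K0eq_zero _) IH.
Qed.

Lemma K0eq_map_delta (J : eqType) (r : seq J) i (a : J -> int) (X : J -> C2) :
  uniq r -> i \in r -> (forall j, a j = (j == i)%:R) ->
  K0eq [seq (a j, X j) | j <- r] [:: (1, X i)].
Proof.
move=> ur ir ha; elim: r ur ir => //= j r IH /andP[jr ur]; rewrite inE.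
have [e _|ne /= ir] := eqVneq i j; last first.
  have -> : a j = 0 by rewrite ha eq_sym (negPf ne).
  by rewrite -[_ :: _]cat1s; apply: K0eq_trans (K0eq_cat (K0eq_zero _) (IH ur ir)) (K0eq_refl _).
case: j / e jr => jr; have -> : a i = 1 by rewrite ha eqxx.
rewrite -[_ :: _]cat1s -[X in K0eq _ X]cats0; apply: K0eq_catl.
have -> : [seq (a j0, X j0) | j0 <- r] = [seq (0, X j) | j <- r].
  apply/eq_in_map => j0 j0r; rewrite ha.
  by have /negPf -> : j0 != i by apply: contraNneq jr => <-.
exact: K0eq_map0.
Qed.

(** Used for zero objects X, which are extensions of X by X. *)
Lemma K0eq_idem X : K0eq [:: (1, X)] [:: (1, X); (1, X)] -> K0eq [:: (1, X)] [::].
Proof.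
move=> h; apply: K0eq_trans (_ : K0eq _ ([:: (1, X)] ++ [:: (1 + -1, X)])) _.
  rewrite subrr; rewrite -[X in K0eq X _]cats0; apply: K0eq_catl; exact/K0eq_sym/K0eq_zero.
apply: K0eq_trans (K0eq_catl _ (K0eq_add _ _ _)) _.
apply: K0eq_trans (K0eq_catr [:: (-1, X)] (K0eq_sym h)) _.
apply: K0eq_trans (K0eq_sym (K0eq_add _ _ _)) _; rewrite subrr; exact: K0eq_zero.
Qed.

(** An additive function on objects factors through the Grothendieck group. *)
Lemma K0eq_additive (A : lmodType int) (phi : C2 -> A) :
  (forall X Y Z, conflation X Y Z -> phi Y = phi X + phi Z) ->
  forall s t, K0eq s t ->
    \sum_(p <- s) p.1 *: phi p.2 = \sum_(p <- t) p.1 *: phi p.2.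
Proof.
move=> hphi s t; elim=> {s t} [//|s t _ -> //|s t u _ -> _ -> //|s s' t t' _ h1 _ h2|s t|X|a b X|X Y Z h].
- by rewrite !big_cat h1 h2.
- by rewrite !big_cat /= addrC.
- by rewrite big_seq1 big_nil scale0r.
- by rewrite !big_cons !big_nil !addr0 scalerDl.
- by rewrite !big_cons !big_nil !addr0 !scale1r (hphi _ _ _ h).
Qed.

(** The stupid filtration of a two-term complex. *)
Lemma conflation_C_Z X : conflation (C_proj (c2_tgt X)) X (Z_obj (c2_src X)).
Proof.
exists 0, \1%VF, \1%VF, 0; split; [exact: ses_zero_id|exact: ses_id_zero| |].
- by rewrite !comp_lfun0r.
- by rewrite !comp_lfun0l.
Qed.

End GrothendieckGroup.

Section IndexCoordinates.
Variables (k : finFieldType) (n : nat) (Q : vquiver 'I_n) (S : species k Q).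
Hypothesis hQ : acyclic Q.
Variable Pi : 'I_n -> projmod S.
Hypothesis hPi : forall i, is_top (Pi i) (simple_smod S i).
Implicit Types (s t u : K0term S) (X Y Z : C2 S).

Definition combination s : Prop := exists h, K0eq s (K0comb Pi h).

Lemma K0comb_add h h' : K0eq (K0comb Pi h ++ K0comb Pi h') (K0comb Pi (h + h')).
Proof.
rewrite /K0comb -!catA; apply: K0eq_trans (K0eq_catl _ (K0eq_move _ _ _)) _; rewrite catA.
apply: K0eq_cat; apply: K0eq_trans (K0eq_map_add _ _ _ _) _;
  by under [X in K0eq _ X]eq_map do rewrite mxE; apply: K0eq_refl.
Qed.

Lemma K0comb0 : K0eq (K0comb Pi 0) [::].
Proof.
by rewrite -[[::]]cats0; apply: K0eq_cat; apply: K0eq_map0 => j; rewrite mxE.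
Qed.

Lemma combination_C i : combination [:: (1, C_proj (Pi i))].
Proof.
exists (delta_mx (lshift n i) 0); rewrite -[X in K0eq X _]cats0; apply: K0eq_sym.
apply: K0eq_cat.
  apply: K0eq_map_delta; rewrite ?enum_uniq ?mem_enum // => j.
  by rewrite mxE eqxx andbT (inj_eq (@lshift_inj _ _)).
by apply: K0eq_map0 => j; rewrite mxE eq_rlshift.
Qed.

Lemma combination_K i : combination [:: (1, K_obj (Pi i))].
Proof.
exists (delta_mx (rshift n i) 0); rewrite -[X in K0eq X _]cat0s; apply: K0eq_sym.
apply: K0eq_cat; first by apply: K0eq_map0 => j; rewrite mxE eq_lrshift.
apply: K0eq_map_delta; rewrite ?enum_uniq ?mem_enum // => j.
by rewrite mxE eqxx andbT (inj_eq (@rshift_inj _ _)).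
Qed.

Lemma combination_nil s : K0eq s [::] -> combination s.
Proof. by move=> h; exists 0; apply: K0eq_trans h (K0eq_sym K0comb0). Qed.

Lemma combination_add s t u : K0eq s (t ++ u) -> combination t -> combination u -> combination s.
Proof.
move=> h [a ha] [b hb]; exists (a + b); apply: K0eq_trans h _.
apply: K0eq_trans (K0eq_cat ha hb) _; exact: K0comb_add.
Qed.

Lemma combination_sub s t u : K0eq s (t ++ u) -> combination s -> combination t -> combination u.
Proof.
move=> h [a ha] [b hb]; exists (- b + a).
apply: K0eq_trans (_ : K0eq u ((K0comb Pi (- b) ++ t) ++ u)) _.
  rewrite -[X in K0eq X _]cat0s; apply: K0eq_catr; apply: K0eq_sym.
  apply: K0eq_trans (K0eq_catl _ hb) _; apply: K0eq_trans (K0comb_add _ _) _.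
  rewrite addNr; exact: K0comb0.
rewrite -catA; apply: K0eq_trans (K0eq_catl _ (K0eq_sym h)) _.
apply: K0eq_trans (K0eq_catl _ ha) _; exact: K0comb_add.
Qed.

(** Induction on dim P, splitting off one indecomposable projective at a time; a split
    exact sequence of projectives gives conflations of the associated complexes. *)
Lemma combination_projective (P : projmod S) :
  combination [:: (1, C_proj P)] /\ combination [:: (1, K_obj P)].
Proof.
move: {2}(\dim {:P}) (erefl (\dim {:P})) => m; elim/ltn_ind: m P => m IH P hm.
have dZ := @dim_zero_smod _ _ _ S.
have [d0|d] := posnP (\dim {:P}).
  split; apply/combination_nil/K0eq_idem/K0eq_ses; exists 0, 0, 0, 0;
    by split; rewrite ?comp_lfun0r ?comp_lfun0l //; apply: ses_zero.
have [i [K [u [g [hs lt]]]]] := split_off hQ hPi d.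
rewrite hm in lt; have [cC cK] := IH _ lt K erefl; split.
  apply: combination_add (_ : K0eq _ ([:: _] ++ [:: _])) cC (combination_C i).
  apply: K0eq_ses; exists 0, u, 0, g; split=> //; first exact: ses_zero.
    by rewrite !comp_lfun0r.
  by rewrite !comp_lfun0r.
apply: combination_add (_ : K0eq _ ([:: _] ++ [:: _])) cK (combination_K i).
apply: K0eq_ses; exists u, u, g, g; split=> //; first by rewrite comp_lfun1l comp_lfun1r.
by rewrite comp_lfun1l comp_lfun1r.
Qed.

(** Every complex is built from some C_P and some Z_P, and the class of Z_P is that of
    K_P minus that of C_P. *)
Lemma combination_obj X : combination [:: (1, X)].
Proof.
have Zc P : combination [:: (1, Z_obj P)].
  have [cC cK] := combination_projective P; apply: combination_sub cK cC.
  exact: K0eq_ses (conflation_C_Z (K_obj P)).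
have [cC _] := combination_projective (c2_tgt X).
apply: combination_add (_ : K0eq _ ([:: _] ++ [:: _])) cC (Zc _).
exact: K0eq_ses (conflation_C_Z X).
Qed.

(** The coordinates are characterized by an equation in the Grothendieck group; applying
    an additive function to it isolates the first n of them. *)
Lemma indo_additive (phi : C2 S -> 'cV[int]_n) :
  (forall X Y Z, conflation X Y Z -> phi Y = phi X + phi Z) ->
  (forall i, phi (C_proj (Pi i)) = delta_mx i 0) ->
  (forall i, phi (K_obj (Pi i)) = 0) ->
  forall X, indo Pi X = phi X.
Proof.
move=> hphi hC hK X; have [h0 hh0] := combination_obj X.
rewrite /indo /K0coords; case: xgetP => [h _ /= hh|/(_ h0)]; last by case.
have := K0eq_additive hphi hh; rewrite big_seq1 scale1r => ->.
rewrite big_cat /= !big_map [X in _ + X]big1 => [|i _]; last by rewrite hK scaler0.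
rewrite addr0 -enumT big_enum /=; apply/colP => i; rewrite mxE summxE (bigD1 i) //= big1 => [|j ne].
  by rewrite hC !mxE !eqxx mulr1 addr0.
by rewrite hC !mxE (eq_sym i) (negPf ne) mulr0.
Qed.

End IndexCoordinates.

(** * Degrees of quantum characters *)

Lemma framed_acyclic (I : finType) (Q : vquiver I) : acyclic Q -> acyclic (framed_quiver Q).
Proof.
move=> hQ x p hp; have [p' pE] : exists p', p = map inl p'.
  elim: p x hp => [|[y|y] p IH] x /=; first by exists [::].
    by move=> /andP[_ /IH[p' ->]]; exists (y :: p').
  by case: x.
subst p; case: x hp => i.
  move=> hp; rewrite last_map => -[e]; rewrite (hQ i p') //.
  by move: hp; rewrite path_map.
by case: p' => //= y p' _; rewrite last_map.
Qed.

Lemma split_lshift m n (j : 'I_m) : fintype.split (lshift n j) = inl j.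
Proof. exact: (unsplitK (inl j)). Qed.

Lemma split_rshift m n (j : 'I_n) : fintype.split (rshift m j) = inr j.
Proof. exact: (unsplitK (inr j)). Qed.

Section Character.
Variables (k : finFieldType) (n : nat) (Q : vquiver 'I_n) (S : species k Q).
Hypothesis hQ : acyclic Q.

Definition Rmat : 'M[int]_n := usubmx (Rt S).

Lemma ext1_fsimple i j : ext1 (fsimple S i) (fsimple S j) =
  \dim {:sp_B (framed_species S) (fintype.split i) (fintype.split j)}.
Proof. by rewrite ext1_simple //; apply: framed_acyclic. Qed.

Lemma dim_end_fsimple i : \dim (homsp (fsimple S i) (fsimple S i)) =
  \dim {:sp_D (framed_species S) (fintype.split i)}.
Proof. by rewrite dim_end_simple. Qed.

Lemma RmatE i j : Rmat i j = (\dim {:sp_B S j i} %/ \dim {:sp_D S i})%N%:Z.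
Proof. by rewrite !mxE ext1_fsimple dim_end_fsimple !split_lshift. Qed.

(** No arrow ends at a framing vertex. *)
Lemma dsubmx_Rt : dsubmx (Rt S) = 0.
Proof.
apply/matrixP => i j.
by rewrite !mxE ext1_fsimple split_lshift split_rshift /= dim_rV0 div0n.
Qed.

(** The framing vertex n + i has a single arrow, to i, with bimodule D_i. *)
Lemma dsubmx_Rt' : dsubmx (Rt' S) = 1%:M.
Proof.
apply/matrixP => i j.
rewrite !mxE ext1_fsimple dim_end_fsimple split_lshift split_rshift.
rewrite sp_dimB sp_dimD /=; have [->|ne] := eqVneq i j; last by rewrite mul0n div0n.
by rewrite mul1n (lcmn_idPl (dvdnn _)) divnn vq_val_gt0.
Qed.

Lemma exponent_submx (e x t : 'cV[int]_n) (a := - Bt S *m e - Et S *m x + col_mx t 0) :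
  usubmx a = - (Bmat S *m e) - (x - usubmx (Rt' S) *m x) + t /\ dsubmx a = x - e.
Proof.
have uE : usubmx (Et S) = 1%:M - usubmx (Rt' S).
  by apply/matrixP => i j; rewrite !mxE (inj_eq (@lshift_inj _ _)).
have dE : dsubmx (Et S) = - 1%:M.
  rewrite /Et linearB /= dsubmx_Rt'; suff -> : dsubmx (It n) = 0 by rewrite sub0r.
  by apply/matrixP => i j; rewrite !mxE eq_rlshift.
have dB : dsubmx (Bt S) = 1%:M by rewrite /Bt linearB /= dsubmx_Rt' dsubmx_Rt subr0.
have subE (C F : 'M[int]_(n + n, n)) :
    (usubmx (- C *m e - F *m x + col_mx t 0) = - (usubmx C *m e) - usubmx F *m x + t) *
    (dsubmx (- C *m e - F *m x + col_mx t 0) = - (dsubmx C *m e) - dsubmx F *m x).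
  by rewrite mulNmx !linearD !linearN /= col_mxKu col_mxKd addr0 -!mul_usub_mx -!mul_dsub_mx.
rewrite /a !subE uE dE dB -/(Bmat S); split; first by rewrite mulmxBl mul1mx.
by rewrite mulNmx opprK !mul1mx addrC.
Qed.

(** The term in e cancels because the grading subtracts B times the lower half of the
    exponent, and the lower half contains - e. *)
Lemma qdeg_exponent (e x t : 'cV[int]_n) :
  qdeg S (- Bt S *m e - Et S *m x + col_mx t 0) = t - (x - Rmat *m x).
Proof.
rewrite /qdeg; have [-> ->] := exponent_submx e x t.
have -> : Bmat S = usubmx (Rt' S) - Rmat by rewrite /Bmat /Bt linearB.
rewrite !(mulmxBl, mulmxBr).
set a := _ *m e; set b := _ *m e; set c := _ *m x; set d := _ *m x.
by apply/colP => i; rewrite !mxE; ring.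
Qed.

(** The l-part of the radical is a sum of copies of the bimodules B_jl, as counted by
    [dim_arrows_into]; dividing by dim D_l gives the entries of R. *)
Lemma dvec_radm (P : smod S) : projective P ->
  dvec P - dimvec (radm P) = dvec P - Rmat *m dvec P.
Proof.
move=> hP; congr (_ - _); apply/colP => i; rewrite [LHS]mxE [RHS]mxE.
under eq_bigr => j _ do rewrite RmatE [dvec P j 0]mxE -PoszM.
rewrite -(big_morph Posz PoszD (erefl _)); congr Posz.
apply/eqP; rewrite -(eqn_pmul2r (dimD_gt0 S i)) (dimv_radm hQ i hP) big_distrl /=.
apply/eqP/eq_bigr => j _; rewrite mulnAC divnK // sp_dimB sp_dimD.
by rewrite dvdn_mull // dvdn_lcmr.
Qed.

Variable L : 'M[int]_(n + n).

Lemma vpow_natr_neq0 (z : int) m : (0 < m)%N -> vpow k z * m%:R != 0.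
Proof.
move=> m0; apply/eqP => /(congr1 val); rewrite rmorphM rmorph_nat rmorph0 /=.
by apply/eqP; rewrite mulf_neq0 ?expfz_neq0 ?vroot_neq0 // pnatr_eq0 -lt0n.
Qed.

Lemma gvec_homogeneous (z : qtorus k L) g a : z@_a != 0 -> homogeneous S z g -> gvec S z = g.
Proof.
move=> za hg; have az : a \in msupp z by rewrite -mcoeff_neq0.
have z0 : z <> 0 by move=> e; move: za; rewrite e mcoeff0 eqxx.
rewrite /gvec; case: xgetP => [g' _ [_ hg']|/(_ g)/(_ (conj z0 hg))//].
by rewrite -(hg _ az) (hg' _ az).
Qed.

Lemma gvec_Xchar (M : smod S) (P : projmod S) :
  gvec S (Xchar L M P) = dvec P - dimvec (radm P) - (dvec M - Rmat *m dvec M).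
Proof.
pose ev (e : {dffun forall i : 'I_n, 'I_(dimv (fullv : {vspace M}) i).+1}) : 'cV[int]_n :=
  \col_i (e i : nat)%:Z.
pose c e := vpow k (euler S (dvec P - ev e) (dvec M - ev e))
  * #|` fset_set (Gr M (fun i => e i : nat))|%:R.
pose a e := - Bt S *m ev e - Et S *m dvec M + top_vec P.
have XE b : (Xchar L M P)@_b = \sum_e (if a e == b then c e else 0).
  rewrite /Xchar raddf_sum; apply: eq_bigr => e _.
  rewrite /= mcoeffZ mcoeffU -/(ev e) -/(c e) -/(a e).
  by case: eqP => _; rewrite ?mulr1 ?mulr0.
have aq e : qdeg S (a e) = dvec P - dimvec (radm P) - (dvec M - Rmat *m dvec M).
  exact: qdeg_exponent.
pose e0 : {dffun forall i : 'I_n, 'I_(dimv (fullv : {vspace M}) i).+1} := [ffun i => ord0].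
(* The monomial of e = 0 occurs with a positive count, as no other e has the
   same exponent. *)
apply: (@gvec_homogeneous _ _ (a e0)); last first.
  move=> b; rewrite -mcoeff_neq0 XE => nz.
  have [[e /eqP <-]|no] := pselect (exists e, a e == b); first exact: aq.
  case/eqP: nz; apply: big1 => e _; case: ifP => // h; by case: no; exists e.
rewrite XE (bigD1 e0) //= eqxx big1 => [|e ne]; last first.
  case: eqP => // ae; case/eqP: ne; apply/ffunP => i; apply/val_inj.
  have : ev e = ev e0.
    have := congr1 dsubmx ae; rewrite (exponent_submx _ _ _).2 (exponent_submx _ _ _).2.
    by move=> /addrI /oppr_inj.
  by move=> /colP/(_ i); rewrite !mxE => -[].
rewrite addr0; apply: vpow_natr_neq0; rewrite cardfs_gt0; apply/fset0Pn; exists 0%VS.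
rewrite in_fset_set ?inE; last exact: vspace_finite.
by split; [exact: submod0|move=> i; rewrite dimv0E ffunE].
Qed.

End Character.

Section IndexFormula.
Variables (k : finFieldType) (n : nat) (Q : vquiver 'I_n) (S : species k Q).
Hypothesis hQ : acyclic Q.
Variable Pi : 'I_n -> projmod S.
Hypothesis hPi : forall i, is_top (Pi i) (simple_smod S i).

(** The quotient of P_i by its radical is S_i. *)
Lemma dvec_top (i : 'I_n) : dvec (Pi i) - dimvec (radm (Pi i)) = delta_mx i 0.
Proof.
have [f [hf sf kf]] := hPi i; apply/colP => l; rewrite !mxE eqxx andbT.
have := dimv_img l (is_hom_Dhom hf) (@Dstablef _ _ _ _ (Pi i)).
by rewrite capfv sf kf simple_dimv => ->; rewrite PoszD addrC addKr; case: eqP.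
Qed.

Definition C2_defect (X : C2 S) : 'cV[int]_n :=
  let x := dvec (c2_tgt X) - dvec (c2_src X) in x - Rmat S *m x.

Lemma dvec_ses (L M N : smod S) (f : 'Hom(L, M)) (g : 'Hom(M, N)) :
  short_exact f g -> dvec M = dvec L + dvec N.
Proof. by move=> h; apply/colP => i; rewrite !mxE (dimv_ses i h). Qed.

Lemma dvec_zero : dvec (zero_smod S) = 0.
Proof. by apply/colP => i; rewrite !mxE dimv_zero_smod. Qed.

Lemma indo_C2_defect (X : C2 S) : indo Pi X = C2_defect X.
Proof.
apply: indo_additive => // {X} [X Y Z [f1 [f0 [g1 [g0 [h1 h0 _ _]]]]]|i|i].
- rewrite /C2_defect (dvec_ses h1) (dvec_ses h0); set x := _ - dvec (c2_src X).
  set z := _ - dvec (c2_src Z).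
  have -> : dvec (c2_tgt X) + dvec (c2_tgt Z) - (dvec (c2_src X) + dvec (c2_src Z)) = x + z.
    by rewrite /x /z opprD addrACA.
  by rewrite mulmxDr opprD addrACA.
- by rewrite /C2_defect /= dvec_zero subr0 -dvec_radm ?dvec_top //; apply: pm_projP.
- by rewrite /C2_defect /= subrr mulmx0 subrr.
Qed.

End IndexFormula.

Theorem proposition7p1 (k : finFieldType) (n : nat) (Q : vquiver 'I_n)
    (hQ : acyclic Q) (S : species k Q)
    (Lam : 'M[int]_(n + n)) (hskew : Lam^T = - Lam)
    (hcompat : Lam *m (- Bt S) =
       col_mx (diag_mx (\row_(i < n) (vq_val Q i)%:Z)) 0)
    (Pi : 'I_n -> projmod S)
    (hPi : forall i : 'I_n,
       indecomposable (Pi i) /\ is_top (Pi i) (simple_smod S i))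
    (M : smod S) (hMind : indecomposable M) (hMrigid : rigid M)
    (res : min_resolution M)
    (P : projmod S) (hP : indecomposable P) :
  gvec S (X_mod Lam M) = - indo Pi (C_obj res) /\
  gvec S (X_shift Lam P) = - indo Pi (Z_obj P).
Proof.
have hT i : is_top (Pi i) (simple_smod S i) by case: (hPi i).
have zr : dimvec (radm (zero_smod S)) = 0.
  by apply/colP => i; rewrite !mxE dimv_zero_smod.
split; rewrite gvec_Xchar // indo_C2_defect // /C2_defect /=.
  rewrite dvec_zero zr subrr sub0r; congr (- _).
  suff -> : dvec (pr_cov res) - dvec (pr_ker res) = dvec M by [].
  by rewrite (dvec_ses (pr_exact res)) [X in X - _]addrC addrK.
rewrite dvec_zero mulmx0 !subr0 sub0r dvec_radm //; last exact: pm_projP.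
by rewrite mulmxN opprD !opprK.
Qed.
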